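(* Let $d\in\mathbb{N}$, let $A_1,\ldots,A_d$ be invertible real $2\times 2$ matrices, and let $\Lambda\subset\mathbb{R}^{2d}$ be a lattice such that $\odot_{i=1}^d A_i\mathbb{Z}^2$ is a subgroup of $\Lambda$ of index $n$. If there exist natural numbers $l_i$, $1\le i\le d$, such that $\sum_{i=1}^d l_i=n$ and $l_i<\det A_i$ for every $1\le i\le d$, then the Gabor system $(\mathfrak{g}_d,\Lambda)$ is incomplete in $L^2(\mathbb{R}^d)$.
   Context: Natural numbers are positive integers. $\mathfrak{g}_d(x)=2^{d/4}e^{-\pi\|x\|^2}$, $x\in\mathbb{R}^d$, is the normalized Gaussian. For $\lambda=(x,\omega)\in\mathbb{R}^d\times\mathbb{R}^d$ the time-frequency shift $\pi(\lambda)$ is defined by $(\pi(\lambda)f)(t)=e^{2\pi i\langle\omega,t\rangle}f(t-x)$. For $\Lambda\subset\mathbb{R}^{2d}=\mathbb{R}^d\times\mathbb{R}^d$ (first $d$ coordinates are time shifts $x$, last $d$ coordinates are frequency shifts $\omega$), the Gabor system is $(g,\Lambda)=\{\pi(\lambda)g:\lambda\in\Lambda\}$. It is complete in $L^2(\mathbb{R}^d)$ if its linear span is dense in $L^2(\mathbb{R}^d)$, and incomplete otherwise. For lattices $\Lambda_1,\ldots,\Lambda_d\subset\mathbb{R}^2$, one sets $\odot_{i=1}^d\Lambda_i=\{(x_1,\ldots,x_d,\omega_1,\ldots,\omega_d)\in\mathbb{R}^{2d}:(x_i,\omega_i)\in\Lambda_i,\ 1\le i\le d\}$. *)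

(* Defs.v *)
From HB Require Import structures.
From mathcomp Require Import all_boot all_order all_algebra.
From mathcomp Require Import complex.
From mathcomp Require Import all_classical all_reals all_analysis.

Set Implicit Arguments.
Unset Strict Implicit.
Unset Printing Implicit Defensive.

Import Order.TTheory GRing.Theory Num.Theory.
Import numFieldNormedType.Exports.

Local Open Scope classical_set_scope.
Local Open Scope ring_scope.

Section lebesgue_step.
Context {R : realType} (n : nat).
Variable mu : {sigma_finite_measure set (n.-tuple R) -> \bar R}.

Definition tuple_of_pair (p : measurableTypeR R * n.-tuple R) : n.+1.-tuple R :=
  [tuple of p.1 :: p.2].

Lemma measurable_tuple_of_pair : measurable_fun setT tuple_of_pair.
Proof. exact: measurable_cons. Qed.

Definition lebesgue_step : set (n.+1.-tuple R) -> \bar R :=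
  pushforward (@lebesgue_measure R \x mu)%E tuple_of_pair.

HB.instance Definition _ := @isMeasurableFun.Build _ _ _ _
  tuple_of_pair measurable_tuple_of_pair.

Let lebesgue_step0 : lebesgue_step set0 = 0%E.
Proof. exact: measure0. Qed.

Let lebesgue_step_ge0 A : (0 <= lebesgue_step A)%E.
Proof. exact: measure_ge0. Qed.

Let lebesgue_step_sigma_additive : semi_sigma_additive lebesgue_step.
Proof.
exact: (@measure_semi_sigma_additive _ _ _
  (pushforward (@lebesgue_measure R \x mu)%E tuple_of_pair)).
Qed.

HB.instance Definition _ := isMeasure.Build _ _ _ lebesgue_step
  lebesgue_step0 lebesgue_step_ge0 lebesgue_step_sigma_additive.

Let lebesgue_step_sigma_finite : sigma_finite setT lebesgue_step.
Proof.
have /sigma_finiteP[F [TF ndF Foo]] := sigma_finiteT (@lebesgue_measure R).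
have /sigma_finiteP[G [TG ndG Goo]] := sigma_finiteT mu.
pose E k := [set t : n.+1.-tuple R | F k (thead t) /\ G k [tuple of behead t]].
exists E.
  apply/esym; rewrite -subTset => t _.
  have [i _ Fi] : (\bigcup_i F i) (thead t) by rewrite -TF.
  have [j _ Gj] : (\bigcup_i G i) [tuple of behead t] by rewrite -TG.
  exists (maxn i j) => //; split.
    by move: Fi; exact/subsetPset/ndF/leq_maxl.
  by move: Gj; exact/subsetPset/ndG/leq_maxr.
move=> k; have [mF Fk] := Foo k; have [mG Gk] := Goo k; split.
  apply: measurableI.
    by rewrite -[X in measurable X]setTI; exact: (measurable_tnth ord0).
  by rewrite -[X in measurable X]setTI; exact: measurable_behead.
rewrite /lebesgue_step /pushforward (_ : _ @^-1` _ = F k `*` G k); last first.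
  rewrite predeqE => -[x t]; rewrite /E /tuple_of_pair /= theadE.
  by rewrite (_ : [tuple of _] = t)//; exact: val_inj.
by rewrite product_measure1E// lte_mul_pinfty// ge0_fin_numE.
Qed.

HB.instance Definition _ := Measure_isSigmaFinite.Build _ _ _ lebesgue_step
  lebesgue_step_sigma_finite.

End lebesgue_step.

(* Borel-Lebesgue measure on R^n, seen as n.-tuple R: the n-fold product of
   the one-dimensional Lebesgue measure, see lebesgue_tuple_box. *)
Fixpoint lebesgue_tuple (R : realType) n :
    {sigma_finite_measure set (n.-tuple R) -> \bar R} :=
  match n with
  | 0%N => \d_([tuple] : 0.-tuple R)
  | m.+1 => lebesgue_step (lebesgue_tuple R m)
  end.

Lemma lebesgue_tuple_box (R : realType) n (B : 'I_n -> set R) :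
  (forall i, measurable (B i)) ->
  lebesgue_tuple R n [set t | forall i, B i (tnth t i)] =
  (\prod_(i < n) @lebesgue_measure R (B i))%E.
Proof.
elim: n B => [|n IHn] B mB.
  by rewrite big_ord0 /= diracE mem_set// => -[].
rewrite big_ord_recl -(IHn (fun i => B (lift ord0 i)))//= /lebesgue_step.
rewrite /pushforward (_ : _ @^-1` _ = B ord0 `*`
    [set t | forall i, B (lift ord0 i) (tnth t i)]); last first.
  rewrite predeqE => -[x t] /=; split=> [Bxt|[Bx Bt] i].
    split=> [|i]; first by have := Bxt ord0.
    have := Bxt (lift ord0 i); rewrite tnthS.
    by congr (B _ (tnth _ _)); exact: val_inj.
  case: (unliftP ord0 i) => [j ->|->]; last by [].
  by rewrite tnthS; have := Bt j; congr (B _ (tnth _ _)); exact: val_inj.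
rewrite product_measure1E//; first exact: mB.
rewrite (_ : [set t | _] = \bigcap_(i in setT)
    ((fun t : n.-tuple R => tnth t i) @^-1` B (lift ord0 i))); last first.
  by rewrite predeqE => t; split=> [Bt i _|Bt i]; [exact: Bt|exact: (Bt i)].
apply: fin_bigcap_measurable => // i _; rewrite -[X in measurable X]setTI.
exact: measurable_tnth.
Qed.

Definition L2norm {R : realType} {d} (f : d.-tuple R -> R[i]) : \bar R :=
  Lnorm (lebesgue_tuple R d) 2%:E (fun t => (ComplexField.Normc.normc (f t))%:E).

(* Elements of L^2 are represented by functions, not by a.e. classes; since
   L2norm is a seminorm on functions, density is unaffected. *)
Definition L2 {R : realType} {d} : set (d.-tuple R -> R[i]) :=
  [set f : d.-tuple R -> R[i] |
    [/\ measurable_fun setT (@complex.Re R \o f),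
        measurable_fun setT (@complex.Im R \o f) & (L2norm f < +oo)%E]].

Definition linear_span {R : realType} {T : Type} (S : set (T -> R[i])) :
    set (T -> R[i]) :=
  [set h | exists (m : nat) (c : 'I_m -> R[i]) (s : 'I_m -> T -> R[i]),
    (forall k, S (s k)) /\ h = (fun t => \sum_(k < m) c k * s k t)].

Definition L2_complete {R : realType} {d} (S : set (d.-tuple R -> R[i])) :
    Prop :=
  forall f, L2 f -> forall e : R, 0 < e ->
    exists2 h, linear_span S h & (L2norm (f \- h)%R < e%:E)%E.

Definition gaussian {R : realType} d (x : d.-tuple R) : R[i] :=
  (2 `^ (d%:R / 4) * expR (- (pi * \sum_(j < d) tnth x j ^+ 2)))%:C%C.

Definition expi {R : realType} (s : R) : R[i] := (cos s +i* sin s)%C.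

(* (pi(x, omega) f)(t) = e^(2 pi i <omega, t>) f(t - x), where lam stacks x on
   top of omega. *)
Definition tfshift {R : realType} {d} (lam : 'cV[R]_(d + d))
    (f : d.-tuple R -> R[i]) : d.-tuple R -> R[i] := fun t =>
  let x := usubmx lam in let omega := dsubmx lam in
  expi (2 * pi * \sum_(j < d) omega j 0 * tnth t j) *
  f [tuple tnth t j - x j 0 | j < d].

Definition gabor {R : realType} {d} (g : d.-tuple R -> R[i])
    (L : set 'cV[R]_(d + d)) : set (d.-tuple R -> R[i]) :=
  [set tfshift lam g | lam in L].

Definition int_image {R : realType} {m} (A : 'M[R]_m) : set 'cV[R]_m :=
  [set A *m map_mx intr k | k in [set: 'cV[int]_m]].

(* Full-rank lattices, spanned over the integers by the columns of A. *)
Definition lattice {R : realType} {m} (L : set 'cV[R]_m) : Prop :=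
  exists2 A : 'M[R]_m, A \in unitmx & L = int_image A.

(* The 2-vector tested against L i is (x_i, omega_i). *)
Definition odot {R : realType} {d} (L : 'I_d -> set 'cV[R]_2) :
    set 'cV[R]_(d + d) :=
  [set v | forall i : 'I_d,
     L i (\col_(k < 2) (if k == 0 then usubmx v i 0 else dsubmx v i 0))].

Definition cosets {V : zmodType} (H G : set V) : set (set V) :=
  [set [set v + h | h in H] | v in G].

Definition subgroup_of_index {V : zmodType} (H G : set V) (n : nat) : Prop :=
  [/\ zmod_closed (mem H), H `<=` G & (cosets H G #= `I_n)%card].

(* Main.v *)
(** It suffices to find tensors [f_N = f_(1,N) (x) ... (x) f_(d,N)], dominated
by one Gaussian, whose pairing with every [pi(lambda) g] tends to 0 while the
pairing with a fixed [F] in L^2 is 1. Deal out the [n] cosets of the product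
lattice in [L] so that coordinate [i] receives [l_i] of them: as the pairing
with a tensor is a product, [f_(i,N)] only has to take care of the translates
of [A_i Z^2] by [l_i] points of the plane, where [l_i < det A_i].

In dimension one, let [v1 = x1 + i w1] and [v2] be a basis of the lattice, with
[x1 <> 0], put [tau = v2 / v1], and let [S > D] be its area. The function
[exp(-(G - pi) t^2) \sum_n C_n exp(G n^2 / v1^2) exp(-2 i G n t / v1)], with
[G] a positive multiple of [v1 / x1] and [Re G] between [pi] and [pi S / D],
pairs with the Gaussian shifted by [z] to an exponential times the theta series
[\sum_n C_n exp(-2 i pi n z / v1)]. For
[C_n = p_(n mod D) exp(i pi tau n^2 / D)] its zero set is invariant under the
lattice, and the [D] free parameters [p] allow any [K < D] prescribed zeros.
Passing to the sublattice spanned by [v1] and [M v2] replaces [l] cosets by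
[l M] ones, and leaves room for an integer [D] with [l M < D < M det A] once [M]
is large. We truncate the series at [N], choosing [p] in terms of [N] such that
the prescribed zeros are exact; the other zeros then appear in the limit, and
no convergence of theta series is needed. *)

Require Import Defs.
From mathcomp Require Import all_boot all_order all_algebra.
From mathcomp Require Import complex.
From mathcomp Require Import all_classical all_reals all_analysis.
From mathcomp Require Import measurable_realfun ring lra zify.
Set Implicit Arguments.
Unset Strict Implicit.
Unset Printing Implicit Defensive.
Import Order.TTheory GRing.Theory Num.Theory.
Import numFieldNormedType.Exports.
Local Open Scope classical_set_scope.
Local Open Scope ring_scope.

Local Notation cRe := (@complex.Re _).
Local Notation cIm := (@complex.Im _).
Local Notation cnorm := ComplexField.Normc.normc.

(** * Complex numbers by real and imaginary parts, and the complex exponential *)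

Section complex_basics.
Context {R : realType}.
Implicit Types (z w : R[i]) (x : R).

Lemma ReD z w : cRe (z + w) = cRe z + cRe w.
Proof. by case: z; case: w. Qed.
Lemma ImD z w : cIm (z + w) = cIm z + cIm w.
Proof. by case: z; case: w. Qed.
Lemma ReM z w : cRe (z * w) = cRe z * cRe w - cIm z * cIm w.
Proof. by case: z; case: w. Qed.
Lemma ImM z w : cIm (z * w) = cRe z * cIm w + cIm z * cRe w.
Proof. by case: z; case: w. Qed.
Lemma ReN z : cRe (- z) = - cRe z.
Proof. by case: z. Qed.
Lemma ImN z : cIm (- z) = - cIm z.
Proof. by case: z. Qed.

Lemma complex_ext z w : cRe z = cRe w -> cIm z = cIm w -> z = w.
Proof. by case: z; case: w => /= a b c d -> ->. Qed.

Lemma cnorm_ge0 z : 0 <= cnorm z.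
Proof. by case: z => a b /=; exact: sqrtr_ge0. Qed.

Lemma cnorm_Re z : `|cRe z| <= cnorm z.
Proof.
case: z => a b /=; rewrite -sqrtr_sqr ler_wsqrtr//.
by rewrite lerDl sqr_ge0.
Qed.

Lemma cnorm_Im z : `|cIm z| <= cnorm z.
Proof.
case: z => a b /=; rewrite -sqrtr_sqr ler_wsqrtr//.
by rewrite lerDr sqr_ge0.
Qed.

Lemma cnorm_sqr z : cnorm z ^+ 2 = cRe z ^+ 2 + cIm z ^+ 2.
Proof. by case: z => a b /=; rewrite sqr_sqrtr// addr_ge0// sqr_ge0. Qed.

Lemma cnorm_le z : cnorm z <= `|cRe z| + `|cIm z|.
Proof.
rewrite -ler_sqr ?nnegrE ?cnorm_ge0 ?addr_ge0// cnorm_sqr.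
rewrite sqrrD !real_normK ?num_real// lerD2r lerDl.
by rewrite mulrn_wge0// mulr_ge0.
Qed.

Lemma cnorm_real x : cnorm x%:C%C = `|x|.
Proof. by rewrite /= expr0n addr0 sqrtr_sqr. Qed.

Lemma cnorm_eq0 z : cnorm z = 0 -> z = 0.
Proof. exact: ComplexField.Normc.eq0_normc. Qed.

Lemma cnormM z w : cnorm (z * w) = cnorm z * cnorm w.
Proof. exact: ComplexField.Normc.normcM. Qed.

Lemma cnormV z : cnorm z^-1 = (cnorm z)^-1.
Proof. exact: ComplexField.Normc.normcV. Qed.

Lemma cnormD z w : cnorm (z + w) <= cnorm z + cnorm w.
Proof. exact: le_normcD. Qed.

Lemma cnormN z : cnorm (- z) = cnorm z.
Proof. exact: normcN. Qed.

Lemma cnorm0 : cnorm (0 : R[i]) = 0.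
Proof. exact: ComplexField.Normc.normc0. Qed.

Lemma cnorm1 : cnorm (1 : R[i]) = 1.
Proof. exact: ComplexField.Normc.normc1. Qed.

Lemma cnorm_sum (I : Type) (r : seq I) (P : pred I) (F : I -> R[i]) :
  cnorm (\sum_(i <- r | P i) F i) <= \sum_(i <- r | P i) cnorm (F i).
Proof.
elim/big_rec2 : _ => [|i y1 y2 _ IH]; first by rewrite cnorm0.
by rewrite (le_trans (cnormD _ _))// lerD2l.
Qed.

Lemma cnorm_prod (I : Type) (r : seq I) (P : pred I) (F : I -> R[i]) :
  cnorm (\prod_(i <- r | P i) F i) = \prod_(i <- r | P i) cnorm (F i).
Proof.
elim/big_rec2 : _ => [|i y1 y2 _ IH]; first exact: cnorm1.
by rewrite cnormM IH.
Qed.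

Lemma expiD x y : expi (x + y : R) = expi x * expi y.
Proof.
rewrite /expi cosD sinD; apply: complex_ext; rewrite ?ReM ?ImM //=.
by rewrite addrC.
Qed.

Lemma cnorm_expi x : cnorm (expi x) = 1.
Proof. by rewrite /= cos2Dsin2 sqrtr1. Qed.

Definition cexp z : R[i] := (expR (cRe z))%:C%C * expi (cIm z).

Lemma cexpD z w : cexp (z + w) = cexp z * cexp w.
Proof.
by rewrite /cexp ReD ImD expRD expiD rmorphM/= mulrACA.
Qed.

Lemma cexp0 : cexp 0 = 1.
Proof. by rewrite /cexp /= expR0 mul1r /expi cos0 sin0. Qed.

Lemma cnorm_cexp z : cnorm (cexp z) = expR (cRe z).
Proof.
by rewrite /cexp cnormM cnorm_expi mulr1 cnorm_real ger0_norm ?expR_ge0.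
Qed.

Lemma cexp_neq0 z : cexp z != 0.
Proof.
apply/eqP => z0; have := cnorm_cexp z; rewrite z0 cnorm0 => /esym/eqP.
by rewrite gt_eqF ?expR_gt0.
Qed.

Lemma Re_cexp z : cRe (cexp z) = expR (cRe z) * cos (cIm z).
Proof. by rewrite /cexp ReM /= mul0r subr0. Qed.

Lemma Im_cexp z : cIm (cexp z) = expR (cRe z) * sin (cIm z).
Proof. by rewrite /cexp ImM /= mul0r addr0. Qed.

Lemma cexp_imag x : cexp (0 +i* x)%C = expi x.
Proof. by rewrite /cexp/= expR0 mul1r. Qed.

End complex_basics.

(** * Complex-valued integrals *)

Section complex_integral.
Context d (T : measurableType d) (R : realType).
Variable mu : {measure set T -> \bar R}.
Implicit Types (f g : T -> R[i]) (c : R[i]).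

Definition cmeasurable f :=
  measurable_fun setT (fun x => cRe (f x)) /\
  measurable_fun setT (fun x => cIm (f x)).

Definition cintegrable f :=
  mu.-integrable setT (EFin \o (fun x => cRe (f x))) /\
  mu.-integrable setT (EFin \o (fun x => cIm (f x))).

Definition cint f : R[i] :=
  ((\int[mu]_x cRe (f x)) +i* (\int[mu]_x cIm (f x)))%C.

Lemma Re_cint f : cRe (cint f) = \int[mu]_x cRe (f x).
Proof. by []. Qed.

Lemma Im_cint f : cIm (cint f) = \int[mu]_x cIm (f x).
Proof. by []. Qed.

Lemma cmeasurableM f g :
  cmeasurable f -> cmeasurable g -> cmeasurable (fun x => f x * g x).
Proof.
move=> [f1 f2] [g1 g2]; split.
  rewrite (_ : (fun _ => _) =
    (fun x => cRe (f x) * cRe (g x) - cIm (f x) * cIm (g x))); last first.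
    by apply/funext => x; rewrite ReM.
  by apply: measurable_funB; exact: measurable_funM.
rewrite (_ : (fun _ => _) =
  (fun x => cRe (f x) * cIm (g x) + cIm (f x) * cRe (g x))); last first.
  by apply/funext => x; rewrite ImM.
by apply: measurable_funD; exact: measurable_funM.
Qed.

Lemma cmeasurableD f g :
  cmeasurable f -> cmeasurable g -> cmeasurable (fun x => f x + g x).
Proof.
move=> [f1 f2] [g1 g2]; split.
  under eq_fun do rewrite ReD; exact: measurable_funD.
under eq_fun do rewrite ImD; exact: measurable_funD.
Qed.

Lemma cmeasurable_cst c : cmeasurable (fun=> c).
Proof. by split; exact: measurable_cst. Qed.

Lemma cmeasurable_sum (I : Type) (r : seq I) (F : I -> T -> R[i]) :
  (forall i, cmeasurable (F i)) ->
  cmeasurable (fun x => \sum_(i <- r) F i x).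
Proof.
move=> mF; elim: r => [|i r IH].
  under eq_fun do rewrite big_nil; exact: cmeasurable_cst.
under eq_fun do rewrite big_cons; exact: cmeasurableD.
Qed.

Lemma cmeasurable_prod (I : Type) (r : seq I) (F : I -> T -> R[i]) :
  (forall i, cmeasurable (F i)) ->
  cmeasurable (fun x => \prod_(i <- r) F i x).
Proof.
move=> mF; elim: r => [|i r IH].
  under eq_fun do rewrite big_nil; exact: cmeasurable_cst.
under eq_fun do rewrite big_cons; exact: cmeasurableM.
Qed.

Lemma cmeasurable_cnorm f :
  cmeasurable f -> measurable_fun setT (fun x => cnorm (f x)).
Proof.
move=> [f1 f2].
rewrite (_ : (fun _ => _) =
    (fun x => Num.sqrt (cRe (f x) ^+ 2 + cIm (f x) ^+ 2))); last first.
  by apply/funext => x; case: (f x).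
apply: (measurableT_comp (continuous_measurable_fun (@sqrt_continuous R))).
by apply: measurable_funD; exact: measurable_funX.
Qed.

Lemma cmeasurable_cexp f :
  cmeasurable f -> cmeasurable (fun x => cexp (f x)).
Proof.
move=> [f1 f2]; split.
  under eq_fun do rewrite Re_cexp.
  apply: measurable_funM; apply: measurableT_comp => //.
  exact: (continuous_measurable_fun (@continuous_cos R)).
under eq_fun do rewrite Im_cexp.
apply: measurable_funM; apply: measurableT_comp => //.
exact: (continuous_measurable_fun (@continuous_sin R)).
Qed.

Lemma cmeasurable_real (u : T -> R) :
  measurable_fun setT u -> cmeasurable (fun x => (u x)%:C%C).
Proof. by move=> mu_; split => //=; exact: measurable_cst. Qed.

Lemma cintegrable_measurable f : cintegrable f -> cmeasurable f.
Proof.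
by move=> [/(measurable_int mu)/measurable_EFinP mf1
           /(measurable_int mu)/measurable_EFinP mf2].
Qed.

Lemma eq_cint f g : f =1 g -> cint f = cint g.
Proof. by move=> fg; congr cint; apply/funext. Qed.

Lemma cintegrableW f (h : T -> R) : cmeasurable f ->
  mu.-integrable setT (EFin \o h) -> (forall x, cnorm (f x) <= h x) ->
  cintegrable f.
Proof.
move=> [f1 f2] ih fh; split; apply: (le_integrable _ _ _ ih) => //.
- exact/measurable_EFinP.
- move=> x _ /=; rewrite lee_fin (le_trans (cnorm_Re _))//.
  by rewrite (le_trans (fh x))// ler_norm.
- exact/measurable_EFinP.
- move=> x _ /=; rewrite lee_fin (le_trans (cnorm_Im _))//.
  by rewrite (le_trans (fh x))// ler_norm.
Qed.

(** The real and imaginary parts are each bounded by the integral of [h], whence the crude factor 2,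
    harmless in estimates that only have to be uniform. *)
Lemma cnorm_cint f (h : T -> R) : cmeasurable f ->
  mu.-integrable setT (EFin \o h) -> (forall x, cnorm (f x) <= h x) ->
  cnorm (cint f) <= 2 * \int[mu]_x h x.
Proof.
move=> mf ih fh; have [if1 if2] := cintegrableW mf ih fh.
rewrite (le_trans (cnorm_le _))//= mulr_natl mulr2n; apply: lerD.
  rewrite (le_trans (le_normr_Rintegral _ if1))//.
  apply: le_Rintegral => //; first exact: integrable_abse if1.
  by move=> x _; rewrite (le_trans (cnorm_Re _)).
rewrite (le_trans (le_normr_Rintegral _ if2))//.
apply: le_Rintegral => //; first exact: integrable_abse if2.
by move=> x _; rewrite (le_trans (cnorm_Im _)).
Qed.

Lemma cintegrableD f g : cintegrable f -> cintegrable g ->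
  cintegrable (fun x => f x + g x).
Proof.
move=> [f1 f2] [g1 g2]; split.
  rewrite (_ : _ \o _ = (EFin \o (fun x => cRe (f x))) \+
    (EFin \o (fun x => cRe (g x))))%E; first exact: integrableD.
  by apply/funext => x /=; rewrite ReD.
rewrite (_ : _ \o _ = (EFin \o (fun x => cIm (f x))) \+
  (EFin \o (fun x => cIm (g x))))%E; first exact: integrableD.
by apply/funext => x /=; rewrite ImD.
Qed.

Lemma cintD f g : cintegrable f -> cintegrable g ->
  cint (fun x => f x + g x) = cint f + cint g.
Proof.
move=> [f1 f2] [g1 g2]; apply: complex_ext; rewrite ?ReD ?ImD /=.
  by under eq_Rintegral do rewrite ReD; rewrite RintegralD.
by under eq_Rintegral do rewrite ImD; rewrite RintegralD.
Qed.

Let integrable_lin (u v : T -> R) (a b : R) :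
  mu.-integrable setT (EFin \o u) -> mu.-integrable setT (EFin \o v) ->
  mu.-integrable setT (EFin \o (fun x => a * u x + b * v x)).
Proof.
move=> iu iv.
rewrite (_ : _ \o _ = (fun x => a%:E * (u x)%:E) \+
                      (fun x => b%:E * (v x)%:E))%E; last first.
  by apply/funext => x /=; rewrite EFinD !EFinM.
by apply: integrableD => //; exact: integrableZl.
Qed.

Let Rintegral_lin (u v : T -> R) (a b : R) :
  mu.-integrable setT (EFin \o u) -> mu.-integrable setT (EFin \o v) ->
  \int[mu]_x (a * u x + b * v x) = a * \int[mu]_x u x + b * \int[mu]_x v x.
Proof.
move=> iu iv; rewrite RintegralD//; last 2 first.
- exact: (integrableZl measurableT a iu).
- exact: (integrableZl measurableT b iv).
by rewrite !RintegralZl.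
Qed.

Lemma cintegrableZ c f : cintegrable f -> cintegrable (fun x => c * f x).
Proof.
move=> [f1 f2]; split.
  have := integrable_lin (cRe c) (- cIm c) f1 f2.
  by congr (integrable _ _ _); apply/funext => x /=; rewrite ReM mulNr.
have := integrable_lin (cRe c) (cIm c) f2 f1.
by congr (integrable _ _ _); apply/funext => x /=; rewrite ImM.
Qed.

Lemma cintZ c f : cintegrable f -> cint (fun x => c * f x) = c * cint f.
Proof.
move=> [f1 f2]; apply: complex_ext; rewrite ?ReM ?ImM /=.
  rewrite -mulNr -Rintegral_lin//; apply: eq_Rintegral => x _.
  by rewrite ReM mulNr.
by rewrite -Rintegral_lin//; apply: eq_Rintegral => x _; rewrite ImM.
Qed.

Lemma cintegrable_sum (I : Type) (r : seq I) (F : I -> T -> R[i]) :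
  (forall i, cintegrable (F i)) ->
  cintegrable (fun x => \sum_(i <- r) F i x).
Proof.
move=> mF; elim: r => [|i r IH].
  rewrite (_ : (fun _ => _) = (fun=> 0)); last first.
    by apply/funext => x; rewrite big_nil.
  by split; exact: integrable0.
under eq_fun do rewrite big_cons; exact: cintegrableD.
Qed.

Lemma cint_sum (I : Type) (r : seq I) (F : I -> T -> R[i]) :
  (forall i, cintegrable (F i)) ->
  cint (fun x => \sum_(i <- r) F i x) = \sum_(i <- r) cint (F i).
Proof.
move=> mF; elim: r => [|i r IH].
  rewrite big_nil; under eq_cint do rewrite big_nil.
  by apply: complex_ext; rewrite /= Rintegral_cst// mul0r.
rewrite big_cons -IH -cintD//; last exact: cintegrable_sum.
by apply: eq_cint => x; rewrite big_cons.
Qed.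

End complex_integral.

Lemma cmeasurable_comp d1 d2 (T1 : measurableType d1) (T2 : measurableType d2)
    (R : realType) (f : T2 -> R[i]) (h : T1 -> T2) :
  measurable_fun setT h -> cmeasurable f -> cmeasurable (fun x => f (h x)).
Proof.
move=> mh [f1 f2].
by split; [exact: (measurableT_comp f1)|exact: (measurableT_comp f2)].
Qed.

(** * Real Gaussians *)

Section gaussian_bounds.
Context {R : realType}.
Local Notation mu := (@lebesgue_measure R).

Lemma integrable_gauss (W c : R) : 0 < c ->
  mu.-integrable setT (EFin \o (fun t => W * expR (- (c * t ^+ 2)))).
Proof.
(* The standard deviation for which the centred normal density has exponent [- c t^2]. *)
move=> c0; pose s := Num.sqrt (c *+ 2)^-1.
have c20 : 0 < c *+ 2 by rewrite mulrn_wgt0.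
have s2 : s ^+ 2 = (c *+ 2)^-1 by rewrite sqr_sqrtr// invr_ge0 ltW.
have s0 : s != 0 by rewrite gt_eqF// sqrtr_gt0 invr_gt0.
pose k := normal_peak s.
have k0 : k != 0 by rewrite gt_eqF// normal_peak_gt0.
have := integrableZl measurableT (W / k) (integrable_normal_pdf 0 s).
congr (integrable _ _ _); apply/funext => t /=.
rewrite normal_pdfE// -EFinM; congr EFin.
rewrite mulrA divfK//; congr (_ * expR _).
rewrite subr0 s2 mulNr; congr (- _).
by rewrite -mulr_natr -[c *+ 2]mulr_natr invfM invrK mulfK ?pnatr_eq0// mulrC.
Qed.

(** Once [1 + |t|] is replaced by [exp |t|], the gap between the exponents is a perfect square over
    [2 a]: half of the quadratic decay pays for the linear growth. *)
Lemma gauss_absorb (a B t : R) : 0 < a ->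
  (1 + `|t|) * expR (- (a * t ^+ 2) + B * `|t|) <=
  expR ((B + 1) ^+ 2 / (2 * a)) * expR (- (a / 2 * t ^+ 2)).
Proof.
move=> a0; apply: (@le_trans _ _ (expR `|t| * expR (- (a * t ^+ 2) + B * `|t|))).
  by rewrite ler_wpM2r ?expR_ge0// expR_ge1Dx.
rewrite -!expRD ler_expR -[t ^+ 2]real_normK ?num_real//.
set y := `|t|; rewrite -subr_ge0.
have -> : (B + 1) ^+ 2 / (2 * a) + - (a / 2 * y ^+ 2) -
   (y + (- (a * y ^+ 2) + B * y)) = (a * y - (B + 1)) ^+ 2 / (2 * a).
  by field; rewrite gt_eqF.
by rewrite divr_ge0 ?sqr_ge0// mulr_ge0// ltW.
Qed.

End gaussian_bounds.

(** * The fundamental theorem of calculus on the whole line *)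

Section ftc_line.
Context {R : realType}.
Local Notation mu := (@lebesgue_measure R).

(** The fundamental theorem on symmetric intervals, followed by dominated convergence. *)
Lemma Rintegral_derive_line (g g' : R -> R) :
  (forall t : R, is_derive t (1 : R) g (g' t)) -> continuous g' ->
  mu.-integrable setT (EFin \o g') ->
  (fun n => g n%:R - g (- n%:R)) @ \oo --> (0 : R) ->
  \int[mu]_t g' t = 0.
Proof.
move=> dg cg' ig' g0.
have cg : continuous g.
  by move=> x; apply: differentiable_continuous; apply/derivable1_diffP; case: (dg x).
(* [n.+1] keeps the endpoints distinct, as the fundamental theorem demands. *)
pose D (n : nat) : set R := `[- n.+1%:R, n.+1%:R]%classic.
pose f_ n := (EFin \o g') \_ (D n).
have cvgI : (\int[mu]_t f_ n t @[n --> \oo] --> \int[mu]_t (g' t)%:E)%E.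
  apply: (@dominated_cvg _ _ _ mu setT measurableT f_ (EFin \o g')
      (abse \o (EFin \o g'))) => //.
  - move=> n; apply/(measurable_restrictT _ (measurable_itv _)).
    apply: (measurable_funS measurableT) => //; exact: measurable_int ig'.
  - move=> t _.
    apply: cvg_near_cst; near=> n; rewrite /f_ patchT// inE /D /= in_itv /=.
    rewrite -ler_norml (@le_trans _ _ n%:R)//; last by rewrite ler_nat.
    by near: n; exact: nbhs_infty_ger.
  - exact: integrable_abse.
  - move=> n t _; rewrite /f_ patchE; case: ifP => //= _.
    by rewrite lee_fin normr0.
have E n : (\int[mu]_t f_ n t = (g n.+1%:R - g (- n.+1%:R))%:E)%E.
  rewrite /f_ -integral_mkcond /D (@continuous_FTC2 _ g' g)//.
  - by rewrite (@lt_trans _ _ 0)// ?oppr_lt0.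
  - exact: continuous_subspaceT.
  - split.
    + by move=> x _; case: (dg x).
    + exact/cvg_at_right_filter/cg.
    + exact/cvg_at_left_filter/cg.
  - by move=> x _; rewrite derive1E; case: (dg x).
have : (\int[mu]_t f_ n t @[n --> \oo] --> 0%:E)%E.
  under eq_fun do rewrite E.
  apply: cvg_EFin; first exact: nearW.
  rewrite (_ : _ \o _ = fun n => (g n.+1%:R - g (- n.+1%:R)))//.
  by rewrite -(cvg_shiftS (fun n => g n%:R - g (- n%:R))) in g0.
move/(cvg_unique (@ereal_hausdorff R) cvgI); rewrite /Rintegral => ->.
by [].
Unshelve. all: end_near. Qed.

End ftc_line.

(** * Derivatives of complex-valued functions of a real variable *)

Section complex_derivative.
Context {R : realType}.
Implicit Types (f g : R -> R[i]) (t : R) (z : R[i]).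

Definition cderive f t z :=
  is_derive t (1 : R) (fun x => cRe (f x)) (cRe z) /\
  is_derive t (1 : R) (fun x => cIm (f x)) (cIm z).

Lemma cderive_eq f t z z' : cderive f t z -> z = z' -> cderive f t z'.
Proof. by move=> ? <-. Qed.

Lemma cderiveD f g t z w : cderive f t z -> cderive g t w ->
  cderive (fun x => f x + g x) t (z + w).
Proof.
move=> [f1 f2] [g1 g2]; split; rewrite ?ReD ?ImD.
  by under eq_fun do rewrite ReD; exact: is_deriveD.
by under eq_fun do rewrite ImD; exact: is_deriveD.
Qed.

Lemma cderiveM f g t z w : cderive f t z -> cderive g t w ->
  cderive (fun x => f x * g x) t (z * g t + f t * w).
Proof.
move=> [f1 f2] [g1 g2]; split.
  under eq_fun do rewrite ReM.
  apply: (is_derive_eq (is_deriveB (is_deriveM f1 g1) (is_deriveM f2 g2))).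
  by rewrite ReD !ReM /GRing.scale /=; ring.
under eq_fun do rewrite ImM.
apply: (is_derive_eq (is_deriveD (is_deriveM f1 g2) (is_deriveM f2 g1))).
by rewrite ImD !ImM /GRing.scale /=; ring.
Qed.

Lemma cderive_cst z t : cderive (fun=> z) t 0.
Proof. by split; exact: is_derive_cst. Qed.

Lemma cderive_id t : cderive (fun x => x%:C%C) t 1.
Proof. by split; [exact: is_derive_id|exact: is_derive_cst]. Qed.

Lemma cderive_cexp f t z : cderive f t z ->
  cderive (fun x => cexp (f x)) t (z * cexp (f t)).
Proof.
move=> [f1 f2]; split.
  under eq_fun do rewrite Re_cexp.
  apply: (is_derive_eq (is_deriveM (is_derive1_comp (is_derive_expR _) f1)
    (is_derive1_comp (is_derive_cos _) f2))).
  by rewrite ReM Re_cexp Im_cexp /GRing.scale /=; ring.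
under eq_fun do rewrite Im_cexp.
apply: (is_derive_eq (is_deriveM (is_derive1_comp (is_derive_expR _) f1)
  (is_derive1_comp (is_derive_sin _) f2))).
by rewrite ImM Re_cexp Im_cexp /GRing.scale /=; ring.
Qed.

Lemma cderive_continuous f (f' : R -> R[i]) : (forall t, cderive f t (f' t)) ->
  continuous (fun t => cRe (f t)) /\ continuous (fun t => cIm (f t)).
Proof.
move=> df; split=> t; apply: differentiable_continuous;
  by apply/derivable1_diffP; case: (df t) => -[] ? ? [].
Qed.

Lemma cderive0_cst f : (forall t, cderive f t 0) -> forall s t, f s = f t.
Proof.
move=> df s t; apply: complex_ext.
  by apply: (@is_derive_0_is_cst _ (fun x => cRe (f x))) => x; case: (df x).
by apply: (@is_derive_0_is_cst _ (fun x => cIm (f x))) => x; case: (df x).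
Qed.

Local Notation mu := (@lebesgue_measure R).

(** Real and imaginary parts are treated separately; the second derivative supplies the continuity
    of [f']. *)
Lemma cint_derive_line f (f' : R -> R[i]) : (forall t, cderive f t (f' t)) ->
  (exists f'', forall t, cderive f' t (f'' t)) -> cintegrable mu f' ->
  (fun n => cnorm (f n%:R) + cnorm (f (- n%:R))) @ \oo --> (0 : R) ->
  cint mu f' = 0.
Proof.
move=> df [f'' df'] [if1 if2] f0.
have [c1 c2] := cderive_continuous df'.
have Re0 : (fun n => cRe (f n%:R) - cRe (f (- n%:R))) @ \oo --> (0 : R).
  apply: norm_cvg0; apply: (squeeze_cvgr _ (cvg_cst 0) f0).
  apply: nearW => n; rewrite normr_ge0 /= (le_trans (ler_normB _ _))//.
  by apply: lerD; exact: cnorm_Re.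
have Im0 : (fun n => cIm (f n%:R) - cIm (f (- n%:R))) @ \oo --> (0 : R).
  apply: norm_cvg0; apply: (squeeze_cvgr _ (cvg_cst 0) f0).
  apply: nearW => n; rewrite normr_ge0 /= (le_trans (ler_normB _ _))//.
  by apply: lerD; exact: cnorm_Im.
apply: complex_ext => /=.
  apply: (@Rintegral_derive_line _ (fun t => cRe (f t))) => // t.
  by case: (df t).
apply: (@Rintegral_derive_line _ (fun t => cIm (f t))) => // t.
by case: (df t).
Qed.

Lemma cderive_cint (F F' : R -> R -> R[i]) (s : R) (G : R -> R) :
  (forall x, x \in `]s - 1, s + 1[ -> cintegrable mu (F x)) ->
  (forall x t, cderive (F^~ t) x (F' x t)) ->
  (forall t, 0 <= G t) -> mu.-integrable setT (EFin \o G) ->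
  (forall x t, x \in `]s - 1, s + 1[ -> cnorm (F' x t) <= G t) ->
  cderive (fun x => cint mu (F x)) s (cint mu (F' s)).
Proof.
move=> iF dF G0 iG FG.
have Is : `]s - 1, s + 1[%classic s.
  by rewrite /= in_itv /= ltrBlDr ltrDl ltr01.
split.
- pose f x t := cRe (F x t).
  have fE x t : partial1of2 f x t = cRe (F' x t).
    by rewrite partial1of2E; case: (dF x t) => -[].
  have fG x t : `]s - 1, s + 1[%classic x -> setT t ->
      `|partial1of2 f x t| <= G t.
    by move=> Ix _; rewrite fE (le_trans (cnorm_Re _))// FG.
  have df x t : `]s - 1, s + 1[%classic x -> setT t ->
      derivable (f^~ t) x 1 by case: (dF x t) => [[]].
  have if_ x (Ix : `]s - 1, s + 1[%classic x) := (iF x Ix).1.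
  apply: DeriveDef.
    exact: (derivable_under_integral measurableT Is if_ df G0 iG fG).
  rewrite -derive1E.
  rewrite (differentiation_under_integral measurableT Is if_ df G0 iG fG).
  by apply: eq_Rintegral => t _; rewrite fE.
- pose f x t := cIm (F x t).
  have fE x t : partial1of2 f x t = cIm (F' x t).
    by rewrite partial1of2E; case: (dF x t) => _ [].
  have fG x t : `]s - 1, s + 1[%classic x -> setT t ->
      `|partial1of2 f x t| <= G t.
    by move=> Ix _; rewrite fE (le_trans (cnorm_Im _))// FG.
  have df x t : `]s - 1, s + 1[%classic x -> setT t ->
      derivable (f^~ t) x 1 by case: (dF x t) => [_ []].
  have if_ x (Ix : `]s - 1, s + 1[%classic x) := (iF x Ix).2.
  apply: DeriveDef.
    exact: (derivable_under_integral measurableT Is if_ df G0 iG fG).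
  rewrite -derive1E.
  rewrite (differentiation_under_integral measurableT Is if_ df G0 iG fG).
  by apply: eq_Rintegral => t _; rewrite fE.
Qed.

End complex_derivative.

(** * Gaussian integrals *)

Section gaussian_integral.
Context {R : realType}.
Local Notation mu := (@lebesgue_measure R).
Variables (G b : R[i]).
Hypothesis G_gt0 : 0 < cRe G.

(** The parameter [s] interpolates between the pure Gaussian at [s = 0] and the integrand of
    interest at [s = 1]. *)
Let F (s t : R) : R[i] := cexp (- (G * t%:C%C ^+ 2) + s%:C%C * b * t%:C%C).

Let F_le (s S t : R) : `|s| <= S ->
  cnorm (F s t) <= expR (- (cRe G * t ^+ 2) + S * cnorm b * `|t|).
Proof.
move=> sS; rewrite cnorm_cexp ler_expR ReD ReN.
have -> : cRe (G * t%:C%C ^+ 2) = cRe G * t ^+ 2.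
  by rewrite expr2 !ReM !ImM /= expr2; ring.
have -> : cRe (s%:C%C * b * t%:C%C) = s * cRe b * t.
  by rewrite !ReM !ImM /=; ring.
rewrite lerD2l (le_trans (ler_norm _))// !normrM.
by rewrite ler_wpM2r// ler_pM// cnorm_Re.
Qed.

Let F_gauss (s S t : R) : `|s| <= S ->
  (1 + `|t|) * cnorm (F s t) <= expR ((S * cnorm b + 1) ^+ 2 / (2 * cRe G)) *
     expR (- (cRe G / 2 * t ^+ 2)).
Proof.
move=> sS; apply: le_trans (gauss_absorb _ _ G_gt0).
by rewrite ler_wpM2l ?F_le// addr_ge0.
Qed.

Let F_meas s : cmeasurable (F s).
Proof.
apply: cmeasurable_cexp; apply: cmeasurableD.
  rewrite (_ : (fun t => _) = fun t => - G * (t%:C%C * t%:C%C)); last first.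
    by apply/funext => t; rewrite expr2 mulNr.
  apply: cmeasurableM; first exact: cmeasurable_cst.
  by apply: cmeasurableM; exact: cmeasurable_real.
apply: cmeasurableM; first exact: cmeasurable_cst.
exact: cmeasurable_real.
Qed.

(** Affine multiples of [F s] include [F s] and its derivatives in [s] and in [t], so this bound,
    uniform for [|s| <= S], serves both integrability and differentiation under the integral. *)
Let lin_F_le (c0 c1 : R[i]) (s S t : R) : `|s| <= S ->
  cnorm ((c0 + c1 * t%:C%C) * F s t) <=
  (cnorm c0 + cnorm c1) * expR ((S * cnorm b + 1) ^+ 2 / (2 * cRe G)) *
     expR (- (cRe G / 2 * t ^+ 2)).
Proof.
move=> sS; rewrite cnormM -mulrA.
apply: (@le_trans _ _ ((cnorm c0 + cnorm c1) * (1 + `|t|) * cnorm (F s t))).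
  rewrite ler_wpM2r ?cnorm_ge0// (le_trans (cnormD _ _))// cnormM cnorm_real.
  rewrite mulrDr mulr1 mulrDl.
  have := cnorm_ge0 c0; have := cnorm_ge0 c1; have := normr_ge0 t.
  set x := cnorm c0; set y := cnorm c1; set z := `|t|; nra.
rewrite -mulrA ler_wpM2l// ?addr_ge0 ?cnorm_ge0//.
exact: F_gauss.
Qed.

Let lin_F_int (c0 c1 : R[i]) (s : R) :
  cintegrable mu (fun t => (c0 + c1 * t%:C%C) * F s t).
Proof.
have a0 : 0 < cRe G / 2 by rewrite divr_gt0.
apply: cintegrableW; last first.
- move=> t; exact: (@lin_F_le c0 c1 s `|s| t (lexx _)).
- exact: integrable_gauss.
apply: cmeasurableM (F_meas s); apply: cmeasurableD (cmeasurable_cst _ _) _.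
exact: cmeasurableM (cmeasurable_cst _ _) (cmeasurable_real _).
Qed.

Let F_int s : cintegrable mu (F s).
Proof.
have := lin_F_int 1 0 s; congr (cintegrable _ _); apply/funext => t.
by rewrite mul0r addr0 mul1r.
Qed.

Let dF1 s t : cderive (F^~ t) s ((0 + b * t%:C%C) * F s t).
Proof.
apply: cderive_eq.
  apply: cderive_cexp; apply: cderiveD; first exact: cderive_cst.
  apply: cderiveM (cderive_cst _ _).
  exact: cderiveM (cderive_id _) (cderive_cst _ _).
rewrite -/(F s t); cbv beta; ring.
Qed.

Let dF2 s t : cderive (F s) t ((s%:C%C * b + (- (2 * G)) * t%:C%C) * F s t).
Proof.
rewrite /F; under [X in cderive X]eq_fun do rewrite -mulNr expr2.
apply: cderive_eq.
  apply: cderive_cexp; apply: cderiveD.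
    apply: cderiveM (cderive_cst _ _) _.
    exact: cderiveM (cderive_id _) (cderive_id _).
  by apply: cderiveM (cderive_cst _ _) (cderive_id _).
cbv beta; rewrite expr2 mulNr; ring.
Qed.

Let F_cvg s : (fun n => cnorm (F s n%:R) + cnorm (F s (- n%:R))) @ \oo -->
  (0 : R).
Proof.
pose K := expR ((`|s| * cnorm b + 1) ^+ 2 / (2 * cRe G)).
have le t : cnorm (F s t) <= K * expR (- (cRe G / 2 * t ^+ 2)).
  apply: le_trans (@F_gauss s _ t (lexx _)).
  by rewrite ler_peMl ?cnorm_ge0// lerDl.
pose q := expR (- (cRe G / 2)).
apply: (@squeeze_cvgr _ _ _ _ (cst 0) (fun n => 2 * K * q ^+ n)).
- apply: nearW => n; rewrite addr_ge0 ?cnorm_ge0//=.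
  (* As [n <= n^2], Gaussian decay at the integers is at least geometric. *)
  have lenn : expR (- (cRe G / 2 * n%:R ^+ 2)) <= q ^+ n.
    rewrite -expRM_natl ler_expR mulrN lerN2 mulrC ler_wpM2l//.
      by rewrite divr_ge0// ltW.
    by rewrite -natrX ler_nat; rewrite -mulnn; case: n => // n; exact: leq_pmulr.
  rewrite mulr_natl mulr2n mulrDl; apply: lerD.
    by rewrite (le_trans (le _))// ler_wpM2l ?expR_ge0.
  by rewrite (le_trans (le _))// sqrrN ler_wpM2l ?expR_ge0.
- exact: cvg_cst.
- rewrite -[X in _ --> X](mulr0 (2 * K)); apply: cvgMr.
  apply: cvg_expr; rewrite ger0_norm ?expR_ge0// expR_lt1.
  by rewrite oppr_lt0 divr_gt0.
Qed.

Lemma cnorm_gaussian_exp t :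
  cnorm (cexp (- (G * t%:C%C ^+ 2) + b * t%:C%C)) <=
  expR ((cnorm b + 1) ^+ 2 / (2 * cRe G)) * expR (- (cRe G / 2 * t ^+ 2)).
Proof.
have := @F_gauss 1 1 t; rewrite normr1 mul1r /F rmorph1 mul1r => /(_ (lexx _)).
by apply: le_trans; rewrite ler_peMl ?cnorm_ge0// lerDl.
Qed.

Lemma cintegrable_gaussian_exp :
  cintegrable mu (fun t => cexp (- (G * t%:C%C ^+ 2) + b * t%:C%C)).
Proof.
have := F_int 1; congr (cintegrable _ _); apply/funext => t.
by rewrite /F rmorph1 mul1r.
Qed.

(* By integration by parts, [int F s * exp(-s^2 b^2 / 4G)] does not depend on
   [s]; compare [s = 1] with [s = 0]. *)
Lemma gaussian_cint :
  cint mu (fun t => cexp (- (G * t%:C%C ^+ 2) + b * t%:C%C)) =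
  cint mu (fun t => cexp (- (G * t%:C%C ^+ 2))) * cexp (b ^+ 2 / (4 * G)).
Proof.
have G0 : G != 0 by apply: contraTneq G_gt0 => ->; rewrite /= ltxx.
have tF_int s : cintegrable mu (fun t => t%:C%C * F s t).
  have := lin_F_int 0 1 s; congr (cintegrable _ _); apply/funext => t.
  by rewrite add0r mul1r.
(* The [t]-derivative of [F s] integrates to 0, which expresses the first moment through the
   integral itself. *)
have ibp s : 2 * G * cint mu (fun t => t%:C%C * F s t) =
             s%:C%C * b * cint mu (F s).
  have : cint mu (fun t => (s%:C%C * b + (- (2 * G)) * t%:C%C) * F s t) = 0.
    apply: (@cint_derive_line _ (F s)) => //.
    eexists => t; apply: cderiveM (dF2 s t).
    apply: cderiveD (cderive_cst _ _) _.
    exact: cderiveM (cderive_cst _ _) (cderive_id _).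
  rewrite (_ : (fun t => _) = fun t => s%:C%C * b * F s t +
      (- (2 * G)) * (t%:C%C * F s t)); last by apply/funext => t; ring.
  rewrite cintD; [|exact: cintegrableZ|exact: cintegrableZ].
  rewrite !cintZ// mulNr => /eqP; rewrite subr_eq0 => /eqP <-.
  by [].
(* With the first moment eliminated, the integral solves a linear differential equation in [s]; [k]
   below multiplies it by the integrating factor. *)
have dj s : cderive (fun x => cint mu (F x)) s
    (s%:C%C * b ^+ 2 / (2 * G) * cint mu (F s)).
  pose S := `|s| + 1.
  apply: cderive_eq.
    apply: (@cderive_cint _ F (fun x t => (0 + b * t%:C%C) * F x t) s
      (fun t => (cnorm 0 + cnorm b) *
        expR ((S * cnorm b + 1) ^+ 2 / (2 * cRe G)) *
        expR (- (cRe G / 2 * t ^+ 2)))).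
    - by move=> x _; exact: F_int.
    - by move=> x t; exact: dF1.
    - by move=> t; rewrite !mulr_ge0 ?expR_ge0// addr_ge0 ?cnorm_ge0.
    - by apply: integrable_gauss; rewrite divr_gt0.
    - move=> x t; rewrite in_itv/= => /andP[x1 x2]; apply: lin_F_le.
      rewrite /S ler_norml; have := ler_norm s; have := ler_norm (- s).
      by rewrite normrN => *; lra.
  have -> : cint mu (fun t => (0 + b * t%:C%C) * F s t) =
            b * cint mu (fun t => t%:C%C * F s t).
    by rewrite -cintZ//; apply: eq_cint => t; ring.
  apply: (@mulfI _ (2 * G)); first by rewrite mulf_neq0// pnatr_eq0.
  rewrite mulrCA ibp; by field.
pose k (s : R) := cexp (- (s%:C%C * s%:C%C * (b ^+ 2 / (4 * G)))) * cint mu (F s).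
have dk s : cderive k s 0.
  apply: cderive_eq.
    apply: cderiveM (dj s); apply: cderive_cexp.
    rewrite (_ : (fun x => _) =
      fun x => - (b ^+ 2 / (4 * G)) * (x%:C%C * x%:C%C)); last first.
      by apply/funext => x; ring.
    apply: cderiveM (cderive_cst _ _) _.
    exact: cderiveM (cderive_id _) (cderive_id _).
  by cbv beta; field.
have k0 : k 0 = cint mu (fun t => cexp (- (G * t%:C%C ^+ 2))).
  rewrite /k rmorph0 !mul0r oppr0 cexp0 mul1r; apply: eq_cint => t.
  by rewrite /F rmorph0 !mul0r addr0.
have k1 : k 1 = cexp (- (b ^+ 2 / (4 * G))) *
    cint mu (fun t => cexp (- (G * t%:C%C ^+ 2) + b * t%:C%C)).
  rewrite /k rmorph1 !mul1r; congr (_ * _); apply: eq_cint => t.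
  by rewrite /F rmorph1 mul1r.
rewrite -k0 -(cderive0_cst dk 1) k1 mulrAC -cexpD addNr cexp0 mul1r.
by [].
Qed.

End gaussian_integral.

(** * Fubini for products of functions of separate variables *)

Section product_integral.
Context d1 d2 (T1 : measurableType d1) (T2 : measurableType d2) (R : realType).
Variables (m1 : {sigma_finite_measure set T1 -> \bar R}).
Variables (m2 : {sigma_finite_measure set T2 -> \bar R}).
Local Notation m12 := (m1 \x m2)%E.

Section real_valued.
Variables (u : T1 -> R) (v : T2 -> R).
Hypothesis iu : m1.-integrable setT (EFin \o u).
Hypothesis iv : m2.-integrable setT (EFin \o v).

Let measurable_prodM : measurable_fun setT (fun p : T1 * T2 => u p.1 * v p.2).
Proof.
have /measurable_EFinP mu_ := measurable_int _ iu.
have /measurable_EFinP mv := measurable_int _ iv.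
by apply: measurable_funM; apply: measurableT_comp.
Qed.

Lemma integrable_prodM :
  m12.-integrable setT (EFin \o (fun p : T1 * T2 => u p.1 * v p.2)).
Proof.
apply/integrable12ltyP; first exact/measurable_EFinP.
have H x : (\int[m2]_y `|(u x * v y)%:E| = \int[m2]_y `|(v y)%:E| * `|(u x)%:E|)%E.
  rewrite -ge0_integralZr//; last first.
    by apply: measurableT_comp => //; exact: measurable_int iv.
  by apply: eq_integral => y _ /=; rewrite normrM mulrC EFinM.
rewrite /=; under eq_integral do rewrite H.
have /integrableP[mv fv] := iv.
have /integrableP[mu_ fu] := iu.
rewrite ge0_integralZl//; last 2 first.
- exact: measurableT_comp.
- exact: integral_ge0.
rewrite lte_mul_pinfty//; first exact: integral_ge0.
by rewrite ge0_fin_numE//; exact: integral_ge0.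
Qed.

Lemma Rintegral_prodM :
  \int[m12]_p (u p.1 * v p.2) = (\int[m1]_x u x) * (\int[m2]_y v y).
Proof.
rewrite {1}/Rintegral -(integral12_prod_meas1 integrable_prodM).
have fv : (\int[m2]_y (v y)%:E)%E \is a fin_num by exact: integrable_fin_num.
have fu : (\int[m1]_y (u y)%:E)%E \is a fin_num by exact: integrable_fin_num.
rewrite -fineM//; congr fine.
rewrite -[X in (_ * X)%E](fineK fv). rewrite -integralZr//.
apply: eq_integral => x _; rewrite fineK// -integralZl//.
Qed.

End real_valued.

Lemma cintegrable_prodM (f : T1 -> R[i]) (g : T2 -> R[i]) :
  cintegrable m1 f -> cintegrable m2 g ->
  cintegrable m12 (fun p => f p.1 * g p.2).
Proof.
move=> [f1 f2] [g1 g2]; split.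
  rewrite (_ : _ \o _ = (EFin \o (fun p => (cRe (f p.1) * cRe (g p.2))%R)) \-
    (EFin \o (fun p => (cIm (f p.1) * cIm (g p.2))%R)))%E.
    exact: (integrableB measurableT (integrable_prodM f1 g1)
      (integrable_prodM f2 g2)).
  by apply/funext => x /=; rewrite ReM EFinB.
rewrite (_ : _ \o _ = (EFin \o (fun p => (cRe (f p.1) * cIm (g p.2))%R)) \+
  (EFin \o (fun p => (cIm (f p.1) * cRe (g p.2))%R)))%E.
  exact: (integrableD measurableT (integrable_prodM f1 g2)
    (integrable_prodM f2 g1)).
by apply/funext => x /=; rewrite ImM EFinD.
Qed.

Lemma cint_prodM (f : T1 -> R[i]) (g : T2 -> R[i]) :
  cintegrable m1 f -> cintegrable m2 g ->
  cint m12 (fun p => f p.1 * g p.2) = cint m1 f * cint m2 g.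
Proof.
move=> [f1 f2] [g1 g2]; apply: complex_ext; rewrite ?ReM ?ImM /=.
  rewrite -(Rintegral_prodM f1 g1) -(Rintegral_prodM f2 g2).
  rewrite -RintegralB//; [|exact: (integrable_prodM f1 g1)|exact: (integrable_prodM f2 g2)].
  by apply: eq_Rintegral => p _; rewrite ReM.
rewrite -(Rintegral_prodM f1 g2) -(Rintegral_prodM f2 g1).
rewrite -RintegralD//; [|exact: (integrable_prodM f1 g2)|exact: (integrable_prodM f2 g1)].
by apply: eq_Rintegral => p _; rewrite ImM.
Qed.

End product_integral.

(** * Tensor products of functions of one variable *)

Section tensor.
Context {R : realType}.
Local Notation mu := (@lebesgue_measure R).

Definition tensor d (u : 'I_d -> R -> R[i]) (t : d.-tuple R) : R[i] :=
  \prod_i u i (tnth t i).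

Lemma tensorM d (u v : 'I_d -> R -> R[i]) t :
  tensor (fun i x => u i x * v i x) t = tensor u t * tensor v t.
Proof. by rewrite /tensor big_split. Qed.

(** Fubini, one coordinate at a time; integrability and value share the induction because splitting
    off a coordinate needs an integrable tail. In dimension 0 the measure is a unit point mass. *)
Lemma cint_tensor d (u : 'I_d -> R -> R[i]) :
  (forall i, cintegrable mu (u i)) ->
  cintegrable (lebesgue_tuple R d) (tensor u) /\
  cint (lebesgue_tuple R d) (tensor u) = \prod_i cint mu (u i).
Proof.
elim: d u => [|d IH] u iu.
  rewrite big_ord0 (_ : tensor u = fun=> 1); last first.
    by apply/funext => t; rewrite /tensor big_ord0.
  have m1 : lebesgue_tuple R 0 setT = 1%E by rewrite /= diracT.
  split; last first.
    apply: complex_ext.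
      transitivity (\int[lebesgue_tuple R 0]_t (1 : R)) => //.
      rewrite Rintegral_cst// mul1r. exact: (f_equal fine m1).
    transitivity (\int[lebesgue_tuple R 0]_t (0 : R)) => //.
    by rewrite Rintegral_cst// mul0r.
  have icst (r : R) : (lebesgue_tuple R 0).-integrable setT (EFin \o (fun=> r)).
    apply/integrableP; split; first exact: measurable_cst.
    rewrite (eq_integral (cst `|r|%:E))// integral_cst//.
    by rewrite (_ : _ setT = 1%E) ?mule1 ?ltry//; exact: m1.
  by split; exact: icst.
have [iv Ev] := IH (fun i => u (lift ord0 i)) (fun i => iu _).
have iw := cintegrable_prodM (iu ord0) iv.
have Ew := cint_prodM (iu ord0) iv.
rewrite big_ord_recl -Ev -Ew.
have E p : tensor u (tuple_of_pair p) =
    u ord0 p.1 * tensor (fun i => u (lift ord0 i)) p.2.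
  rewrite /tensor big_ord_recl; congr (_ * _).
  by apply: eq_bigr => i _; rewrite tnthS; congr (u _ (tnth _ _)); exact: val_inj.
have mu_ : cmeasurable (tensor u).
  apply: cmeasurable_prod => i.
  apply: (cmeasurable_comp (f := u i) (h := fun t : d.+1.-tuple R => tnth t i)).
    exact: measurable_tnth.
  exact: cintegrable_measurable (iu i).
have mE := @measurable_tuple_of_pair R d.
have [[mr mi] [wr wi]] := (mu_, iw).
split; last first.
  apply: complex_ext => /=.
    congr fine; rewrite (integral_pushforward mE)//.
    - by apply: eq_integral => p _ /=; rewrite E.
    - exact/measurable_EFinP.
    - by move: wr; congr (integrable _ _ _); apply/funext => p /=; rewrite E.
  congr fine; rewrite (integral_pushforward mE)//.
  - by apply: eq_integral => p _ /=; rewrite E.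
  - exact/measurable_EFinP.
  - by move: wi; congr (integrable _ _ _); apply/funext => p /=; rewrite E.
split; apply: (integrable_pushforward mE) => //.
- exact/measurable_EFinP.
- by move: wr; congr (integrable _ _ _); apply/funext => p /=; rewrite E.
- exact/measurable_EFinP.
- by move: wi; congr (integrable _ _ _); apply/funext => p /=; rewrite E.
Qed.

End tensor.

(** * Theta functions *)

Section exponential_sums.
Context {R : realType}.
Implicit Types (a : int -> R[i]) (n k : int) (N : nat).

Local Notation "n %:IC" := ((n%:~R : R)%:C%C) (at level 2, format "n %:IC").

(* The sum over the window [-N <= n < N]. *)
Definition wsum (V : nmodType) N (a : int -> V) : V :=
  \sum_(k < N) (a (Posz k) + a (Negz k)).

Lemma eq_wsum (V : nmodType) N (a b : int -> V) : a =1 b -> wsum N a = wsum N b.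
Proof. by move=> ab; apply: eq_bigr => i _; rewrite !ab. Qed.

Lemma wsum0 (V : nmodType) (a : int -> V) : wsum 0 a = 0.
Proof. by rewrite /wsum big_ord0. Qed.

Lemma wsumS (V : nmodType) N (a : int -> V) :
  wsum N.+1 a = wsum N a + (a (Posz N) + a (Negz N)).
Proof. by rewrite /wsum big_ord_recr. Qed.

Lemma wsumZ N a (c : R[i]) : wsum N (fun n => c * a n) = c * wsum N a.
Proof. by rewrite /wsum mulr_sumr; apply: eq_bigr => i _; rewrite mulrDr. Qed.

Lemma wsum_sum (I : finType) N (F : I -> int -> R[i]) :
  wsum N (fun n => \sum_i F i n) = \sum_i wsum N (F i).
Proof.
rewrite /wsum exchange_big/=; apply: eq_bigr => k _.
by rewrite -big_split.
Qed.

Lemma cint_wsum d (T : measurableType d) (mu : {measure set T -> \bar R}) N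
    (F : int -> T -> R[i]) : (forall n, cintegrable mu (F n)) ->
  cint mu (fun t => wsum N (fun n => F n t)) = wsum N (fun n => cint mu (F n)).
Proof.
move=> iF; rewrite /wsum cint_sum => [|k]; last exact: cintegrableD.
by apply: eq_bigr => k _; rewrite cintD.
Qed.

Lemma cmeasurable_wsum d (T : measurableType d) N (F : int -> T -> R[i]) :
  (forall n, cmeasurable (F n)) ->
  cmeasurable (fun t => wsum N (fun n => F n t)).
Proof. by move=> mF; apply: cmeasurable_sum => k; exact: cmeasurableD. Qed.

Lemma cnorm_wsum N a : cnorm (wsum N a) <= wsum N (fun n => cnorm (a n)).
Proof.
by rewrite (le_trans (cnorm_sum _ _ _))//; apply: ler_sum => i _; exact: cnormD.
Qed.

Lemma ler_wsum N (a b : int -> R) : (forall n, a n <= b n) -> wsum N a <= wsum N b.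
Proof. by move=> ab; apply: ler_sum => i _; exact: lerD. Qed.

(** The window is an interval of integers, so a unit shift gains one term at one end and loses one
    at the other. *)
Lemma wsum_shift N a :
  wsum N (fun n => a (n - 1)) = wsum N a + a (Negz N) - a (N%:Z - 1).
Proof.
elim: N => [|N IH]; first by rewrite !wsum0 add0r subrr.
rewrite !wsumS IH.
have -> : Negz N - 1 = Negz N.+1 by rewrite !NegzE; lia.
have -> : N.+1%:Z - 1 = N by lia.
ring.
Qed.

Lemma wsum_shiftN N a :
  wsum N (fun n => a (n + 1)) = wsum N a + a N%:Z - a (Negz N + 1).
Proof.
elim: N => [|N IH].
  by rewrite !wsum0 add0r NegzE (_ : - 1%:Z + 1 = 0) ?subrr.
rewrite !wsumS IH.
have -> : N%:Z + 1 = N.+1 by lia.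
have -> : Negz N.+1 + 1 = Negz N by rewrite !NegzE; lia.
ring.
Qed.

Lemma wsum_delta (V : nmodType) N (r : nat) (v : V) : (r < N)%N ->
  wsum N (fun n => if n == Posz r then v else 0) = v.
Proof.
move=> rN; rewrite /wsum (bigD1 (Ordinal rN))//= eqxx addr0 big1 ?addr0// => i.
by rewrite -val_eqE/= eqz_nat => /negbTE ->; rewrite addr0.
Qed.

(** A common yardstick: Gaussian coefficients of any width decay at least this fast up to a
    constant, and shifts only change the constant. *)
Definition edecay n : R := expR (- `|n|%:R).

Lemma edecay_le n (m j : nat) : (m <= `|n| + j)%N ->
  edecay n <= expR j%:R * expR (- m%:R).
Proof.
rewrite -(ler_nat R) natrD /edecay -expRD ler_expR => h.
by rewrite lerBrDr -lerBrDl opprK addrC.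
Qed.

Lemma edecay_le0 n (m : nat) : (m <= `|n|)%N -> edecay n <= expR (- m%:R).
Proof. by rewrite /edecay ler_expR lerN2 ler_nat. Qed.

Lemma edecay_shift n k : edecay (n + k) <= expR `|k|%:R * edecay n.
Proof. by apply: edecay_le; lia. Qed.

Lemma edecay_wsum : exists2 W : R, 0 <= W & forall N, wsum N edecay <= W.
Proof.
pose q : R := expR (-1).
have q1 : q < 1 by rewrite expR_lt1 oppr_lt0.
have q0 : 0 <= q by exact: expR_ge0.
exists (2 / (1 - q)) => [|N]; first by rewrite divr_ge0// subr_ge0 ltW.
have E (j : nat) : expR (- j%:R) = q ^+ j.
  by rewrite -expRM_natl mulrN1.
apply: (@le_trans _ _ (\sum_(k < N) (2 * q ^+ k))).
  apply: ler_sum => k _; rewrite /edecay /= !E mulr_natl mulr2n lerD2l.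
  by rewrite exprS ler_piMl ?exprn_ge0// ltW.
rewrite -mulr_sumr ler_wpM2l// -[leRHS]mul1r ler_pdivlMr ?subr_gt0//.
rewrite mulrC -opprB mulNr -subrX1 opprB lerBlDr lerDl.
exact: exprn_ge0.
Qed.

(** Shifting a window sum that vanishes exactly leaves only boundary terms, of order [exp(-N)]. The
    constant depends on [K] and [k] alone, so [a] may vary with [N]. This stands in for the
    invariance of the zeros of a convergent theta series. *)
Lemma wsum_shift_small (K : R) k : exists M : R, forall N a,
  (forall n, cnorm (a n) <= K * edecay n) -> wsum N a = 0 ->
  cnorm (wsum N (fun n => a (n + k))) <= M * expR (- N%:R).
Proof.
have e1 (b : int -> R[i]) (L : R) N : (forall n, cnorm (b n) <= L * edecay n) ->
    [/\ cnorm (b (Negz N)) <= L * expR (- N%:R),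
        cnorm (b (N%:Z - 1)) <= L * expR 1%:R * expR (- N%:R),
        cnorm (b N%:Z) <= L * expR (- N%:R) &
        cnorm (b (Negz N + 1)) <= L * expR 1%:R * expR (- N%:R)].
  move=> bL.
  have L0 : 0 <= L.
    rewrite -(@pmulr_lge0 _ (edecay 0)) ?expR_gt0//.
    exact: le_trans (cnorm_ge0 _) (bL 0).
  split; rewrite (le_trans (bL _))// -?mulrA ler_wpM2l//.
  - by apply: edecay_le0; lia.
  - by apply: edecay_le; lia.
  - by apply: edecay_le; lia.
have sh a : (forall n, cnorm (a n) <= K * edecay n) ->
    forall k n, cnorm (a (n + k)) <= K * expR `|k|%:R * edecay n.
  move=> aK j n; rewrite (le_trans (aK _))// -mulrA ler_wpM2l ?edecay_shift//.
  rewrite -(@pmulr_lge0 _ (edecay 0)) ?expR_gt0//.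
  exact: le_trans (cnorm_ge0 _) (aK 0).
(* The shift moves away from 0 one unit at a time; each unit adds two boundary terms, controlled by
   [e1]. *)
elim/int_ind : k => [|k [M IH]|k [M IH]].
- exists 0 => N a aK a0; rewrite mul0r (_ : wsum _ _ = 0) ?cnorm0//.
  by rewrite -[RHS]a0; apply: eq_wsum => n; rewrite addr0.
- pose L := K * expR `|k|%:R.
  exists (M + L + L * expR 1%:R) => N a aK a0.
  have [_ _ h1 h2] := e1 (fun n => a (n + k)) L N (sh a aK k).
  rewrite (_ : wsum _ _ = wsum N (fun n => a (n + 1 + k))); last first.
    by apply: eq_wsum => n; rewrite -addrA -intS.
  rewrite (wsum_shiftN N (fun n => a (n + k))).
  rewrite (le_trans (cnormD _ _))// cnormN !mulrDl lerD//.
  by rewrite (le_trans (cnormD _ _))// lerD// IH.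
- pose L := K * expR `|- (k%:Z)|%:R.
  exists (M + L + L * expR 1%:R) => N a aK a0.
  have [h1 h2 _ _] := e1 (fun n => a (n - k%:Z)) L N (sh a aK (- k%:Z)).
  rewrite (_ : wsum _ _ = wsum N (fun n => a (n - 1 - k%:Z))); last first.
    by apply: eq_wsum => n; congr a; lia.
  rewrite (wsum_shift N (fun n => a (n - k%:Z))).
  rewrite (le_trans (cnormD _ _))// cnormN !mulrDl lerD//.
  by rewrite (le_trans (cnormD _ _))// lerD// IH.
Qed.

Lemma expR_natN_small (M e : R) : 0 < e ->
  exists N0 : nat, forall N, (N0 <= N)%N -> M * expR (- N%:R) <= e.
Proof.
move=> e0; exists (Num.truncn (`|M| / e)).+1 => N hN.
have N0 : 0 < expR N%:R :> R by exact: expR_gt0.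
rewrite expRN -ler_pdivlMr ?invr_gt0// invrK.
rewrite (le_trans (ler_norm _))// -ler_pdivrMl// mulrC.
apply: le_trans (expR_ge1Dx _); rewrite (@le_trans _ _ N%:R)//; last first.
  by rewrite lerDr.
rewrite (le_trans (ltW (truncnS_gt _)))// ler_nat//.
Qed.

(** Completing the square lets the quadratic term absorb both the linear exponent and [|n|]. *)
Lemma cexp_quad_decay (al be : R[i]) : cRe al < 0 ->
  exists2 K : R, 0 <= K &
    forall n, cnorm (cexp (al * n%:IC ^+ 2 + be * n%:IC)) <= K * edecay n.
Proof.
move=> al0; pose c := - cRe al.
have c0 : 0 < c by rewrite oppr_gt0.
exists (expR ((`|cRe be| + 1) ^+ 2 / (4 * c))) => [|n]; first exact: expR_ge0.
rewrite cnorm_cexp /edecay -expRD ler_expR.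
have -> : cRe (al * n%:IC ^+ 2 + be * n%:IC) = - c * n%:~R ^+ 2 + cRe be * n%:~R.
  by rewrite ReD expr2 !ReM !ImM /= /c expr2; ring.
have -> : `|n|%:R = `|n%:~R| :> R by rewrite -intr_norm natr_absz.
rewrite -[n%:~R ^+ 2]real_normK ?num_real//; set y : R := `|n%:~R|.
apply: (@le_trans _ _ (- c * y ^+ 2 + `|cRe be| * y)).
  by rewrite lerD2l /y -normrM ler_norm.
set b := `|cRe be|; rewrite -subr_ge0.
have -> : (b + 1) ^+ 2 / (4 * c) - y - (- c * y ^+ 2 + b * y) =
  (2 * c * y - (b + 1)) ^+ 2 / (4 * c) by field; rewrite gt_eqF.
by rewrite divr_ge0 ?sqr_ge0// mulr_ge0// ltW.
Qed.

Lemma expi_int n : expi (2 * pi * n%:~R : R) = 1.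
Proof.
have : expi (2 * pi : R) = 1 by rewrite mulr_natl /expi cos2pi sin2pi.
move: (2 * pi) => P e2.
have en (m : nat) : expi (P * m%:R) = 1.
  elim: m => [|m IH]; first by rewrite mulr0 /expi cos0 sin0.
  by rewrite -natr1 mulrDr mulr1 expiD IH e2 mulr1.
case: n => m; first exact: en.
have := expiD (P * m.+1%:R) (P * (Negz m)%:~R).
rewrite en mul1r => <-; rewrite -mulrDr NegzE mulrNz subrr mulr0.
by rewrite /expi cos0 sin0.
Qed.

End exponential_sums.

(** With fewer equations than unknowns the left kernel is nonzero; a vector in it is divided by an
    entry of largest modulus. The entry 1 will fix the pairing with a dual function, and the bound
    on all entries gives domination independent of the vector. *)
Lemma small_kernel (R : realType) (K D : nat) (M : 'M[R[i]]_(D, K)) :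
  (K < D)%N -> exists p : 'rV[R[i]]_D, exists r : 'I_D,
  [/\ p *m M = 0, p 0 r = 1 & forall s, cnorm (p 0 s) <= 1].
Proof.
move=> KD.
have kM0 : kermx M != 0.
  rewrite -mxrank_eq0 mxrank_ker subn_eq0 -ltnNge.
  exact: leq_ltn_trans (rank_leq_col _) KD.
have /rowV0Pn[u /sub_kermxP uM u0] : kermx M != 0 by [].
have [s us] : exists s, u 0 s != 0 by apply/rV0Pn.
pose r := [arg max_(i > s) cnorm (u 0 i)]%O.
have rmax i : cnorm (u 0 i) <= cnorm (u 0 r).
  by rewrite /r; case: arg_maxP => // j _; apply.
have ur0 : 0 < cnorm (u 0 r).
  apply: lt_le_trans (rmax s); rewrite lt_neqAle cnorm_ge0 andbT eq_sym.
  by apply: contraNneq us => /cnorm_eq0 ->.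
exists ((u 0 r)^-1 *: u), r; split.
- by rewrite -scalemxAl uM scaler0.
- rewrite mxE mulVf//; apply: contraTneq ur0 => ->.
  by rewrite cnorm0 ltxx.
- move=> i; rewrite mxE cnormM cnormV mulrC ler_pdivrMr// mul1r.
  exact: rmax.
Qed.

(** * Gaussian domination, and orthogonality of exponentials over a period *)

Section trigonometric_integral.
Context {R : realType}.
Local Notation mu := (@lebesgue_measure R).

(* Lebesgue measure lives on [measurableTypeR R], whose display differs from that
   of the measurable structure inferred for [R]. *)
Local Notation cmeasurableR := (@cmeasurable _ (measurableTypeR R) R).

(** [W] and [c] are explicit so that a whole sequence of functions can share them. *)
Definition gauss_dom (W c : R) (f : R -> R[i]) :=
  cmeasurableR f /\ forall t, cnorm (f t) <= W * expR (- (c * t ^+ 2)).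

Lemma gauss_dom_int W c f : 0 < c -> gauss_dom W c f -> cintegrable mu f.
Proof. by move=> c0 [mf fW]; exact: (cintegrableW mf (integrable_gauss W c0) fW). Qed.

Lemma gauss_domM (W c W' c' : R) (f g : R -> R[i]) :
  gauss_dom W c f -> gauss_dom W' c' g ->
  gauss_dom (W * W') (c + c') (fun t => f t * g t).
Proof.
move=> [mf fW] [mg gW]; split=> [|t]; first exact: cmeasurableM.
rewrite cnormM mulrDl opprD expRD mulrACA.
by rewrite ler_pM ?cnorm_ge0.
Qed.

Lemma gauss_domZ (W c : R) (a : R[i]) (f : R -> R[i]) :
  gauss_dom W c f -> gauss_dom (cnorm a * W) c (fun t => a * f t).
Proof.
move=> [mf fW]; split=> [|t]; first exact: cmeasurableM (cmeasurable_cst _ _) mf.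
by rewrite cnormM -mulrA ler_wpM2l ?cnorm_ge0.
Qed.

Lemma gauss_dom_gaussian_exp (G b : R[i]) : 0 < cRe G ->
  gauss_dom (expR ((cnorm b + 1) ^+ 2 / (2 * cRe G))) (cRe G / 2)
    (fun t => cexp (- (G * t%:C%C ^+ 2) + b * t%:C%C)).
Proof.
move=> G0; split=> [|t]; last exact: cnorm_gaussian_exp.
exact: cintegrable_measurable (cintegrable_gaussian_exp b G0).
Qed.

Definition wave (T th t : R) : R[i] := (\1_`[0, T]%classic t)%:C%C * expi (th * t).

Lemma cmeasurable_wave T th : cmeasurableR (wave T th).
Proof.
apply: cmeasurableM.
  by apply: cmeasurable_real; apply: measurable_indic; exact: measurable_itv.
split => /=.
  apply: (measurableT_comp (continuous_measurable_fun (@continuous_cos R))).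
  exact: measurable_funM.
apply: (measurableT_comp (continuous_measurable_fun (@continuous_sin R))).
exact: measurable_funM.
Qed.

Lemma cintegrable_wave T th : cintegrable mu (wave T th).
Proof.
apply: (@cintegrableW _ _ _ mu (wave T th) (fun t => \1_`[0, T]%classic t)).
- exact: cmeasurable_wave.
- exact: integrable_indic_itv.
- by move=> t; rewrite cnormM cnorm_expi mulr1 cnorm_real ger0_norm.
Qed.

Let Rint_indic T (u : R -> R) :
  \int[mu]_t (\1_`[0, T]%classic t * u t) = \int[mu]_(t in `[0, T]) u t.
Proof.
rewrite [RHS]Rintegral_mkcond; apply: eq_Rintegral => t _.
by rewrite patchE indicE; case: ifP => _; rewrite ?mul1r ?mul0r.
Qed.

Lemma cint_wave0 T : 0 <= T -> cint mu (wave T 0) = T%:C%C.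
Proof.
move=> T0; apply: complex_ext; [rewrite Re_cint|rewrite Im_cint].
  transitivity (\int[mu]_t (\1_`[0, T]%classic t * 1)).
    by apply: eq_Rintegral => t _; rewrite /wave ReM /= !mul0r cos0 subr0.
  rewrite Rint_indic Rintegral_cst; last exact: measurable_itv.
  rewrite mul1r /= lebesgue_measure_itv/= lte_fin ?subr0.
  by move: T0; rewrite le_eqVlt => /predU1P[<-|->];
    rewrite ?ltxx//= ?oppr0 ?subr0 ?addr0.
transitivity (\int[mu]_t (0 : R)); last by rewrite Rintegral_cst// mul0r.
by apply: eq_Rintegral => t _; rewrite /wave ImM /= !mul0r sin0 mulr0 addr0.
Qed.

Let Rint_FTC T (u U : R -> R) : 0 < T -> continuous u ->
  (forall t : R, is_derive t (1 : R) U (u t)) ->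
  \int[mu]_(t in `[0, T]) u t = U T - U 0.
Proof.
move=> T0 cu dU.
have cU : continuous U.
  by move=> x; apply: differentiable_continuous; apply/derivable1_diffP; case: (dU x).
rewrite /Rintegral (@continuous_FTC2 _ u U)//.
- exact: continuous_subspaceT.
- split.
  + by move=> x _; case: (dU x).
  + exact/cvg_at_right_filter/cU.
  + exact/cvg_at_left_filter/cU.
- by move=> x _; rewrite derive1E; case: (dU x).
Qed.

Let is_derive_scale (k : R) (u : R -> R) (t du : R) :
  is_derive t (1 : R) u du -> is_derive t (1 : R) (fun x => k * u x) (k * du).
Proof.
move=> ?; apply: (is_derive_eq (is_deriveM (is_derive_cst k _ _) _)).
by rewrite /GRing.scale/= mulr0 addr0.
Qed.

(** The antiderivatives [sin / th] and [- cos / th] agree at both ends, as [T] is a whole number of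
    periods. *)
Lemma cint_wave T th : 0 < T -> th != 0 -> expi (th * T) = 1 ->
  cint mu (wave T th) = 0.
Proof.
move=> T0 th0 [cosT sinT].
have dth (t : R) : is_derive t (1 : R) (fun x => th * x) th.
  by apply: (is_derive_eq (is_derive_scale th (is_derive_id _ _))); rewrite mulr1.
have cth : continuous (fun x : R => th * x).
  by move=> x; apply: differentiable_continuous; apply/derivable1_diffP; case: (dth x).
apply: complex_ext; [rewrite Re_cint|rewrite Im_cint].
  transitivity (\int[mu]_t (\1_`[0, T]%classic t * cos (th * t))).
    by apply: eq_Rintegral => t _; rewrite /wave ReM /= !mul0r subr0.
  have dU (t : R) : is_derive t (1 : R) (fun t => th^-1 * sin (th * t)) (cos (th * t)).
    apply: (is_derive_eq (is_derive_scale th^-1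
      (is_derive1_comp (is_derive_sin _) (dth t)))).
    by rewrite mulrCA mulVf// mulr1.
  rewrite Rint_indic (Rint_FTC T0 _ dU).
    by rewrite sinT !mulr0 sin0 mulr0 subr0.
  by move=> x; apply: continuous_comp; [exact: cth|exact: continuous_cos].
transitivity (\int[mu]_t (\1_`[0, T]%classic t * sin (th * t))).
  by apply: eq_Rintegral => t _; rewrite /wave ImM /= !mul0r addr0.
have dU (t : R) : is_derive t (1 : R) (fun t => - th^-1 * cos (th * t)) (sin (th * t)).
  apply: (is_derive_eq (is_derive_scale (- th^-1)
    (is_derive1_comp (is_derive_cos _) (dth t)))).
  by rewrite mulNr mulNr mulrN opprK mulrCA mulVf// mulr1.
rewrite Rint_indic (Rint_FTC T0 _ dU).
  by rewrite cosT mulr0 cos0 subrr.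
by move=> x; apply: continuous_comp; [exact: cth|exact: continuous_sin].
Qed.

End trigonometric_integral.

(** * Truncated theta windows for the lattice with basis [v1], [v2] *)

Section theta_windows.
Context {R : realType}.
Local Notation mu := (@lebesgue_measure R).
Local Notation cmeasurableR := (@cmeasurable _ (measurableTypeR R) R).
Local Notation "n %:IC" := ((n%:~R : R)%:C%C) (at level 2, format "n %:IC").

Variables (D' : nat) (x1 w1 : R) (v2 : R[i]).
Let D := D'.+1.
Let v1 : R[i] := (x1 +i* w1)%C.
Let S : R := x1 * cIm v2 - cRe v2 * w1.
Hypothesis x1_neq0 : x1 != 0.
Hypothesis DS : D%:R < S.

(* [del] is purely imaginary because [G] is a real multiple of [v1]. Hence the
   window is a Gaussian, decaying as [pi < Re G = X], times a trigonometric
   series, converging as [X < pi S / D]. *)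
Let X : R := pi * (1 + S / D%:R) / 2.
Let G : R[i] := (X / x1)%:C%C * v1.
Let del : R[i] := (0 +i* (- (2 * X / x1)))%C.
Let al : R[i] := (pi / D%:R)%:C%C * 'i%C * v2 / v1.
(** Pairing with a shifted Gaussian adds [del^2 n^2 / (4 G)] to the exponent. [kap] subtracts it in
    advance, so that the theta series of the pairing has quadratic coefficient [al = i pi tau / D],
    where [tau = v2 / v1]. *)
Let kap : R[i] := al - del ^+ 2 / (4 * G).

Let D0 : 0 < D%:R :> R. Proof. by rewrite ltr0n. Qed.

Let X_gt_pi : pi < X.
Proof.
have := pi_gt0 R; rewrite /X; move: (pi : R) => P P0.
have : 1 < S / D%:R by rewrite ltr_pdivlMr// mul1r.
move: (S / _) => s s1; nra.
Qed.

Let X_lt : X < pi * S / D%:R.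
Proof.
have := pi_gt0 R; rewrite /X -mulrA; move: (pi : R) => P P0.
have : 1 < S / D%:R by rewrite ltr_pdivlMr// mul1r.
rewrite -!mulrA; move: (S / _) => s s1; nra.
Qed.

Let X_gt0 : 0 < X. Proof. exact: lt_trans (pi_gt0 R) X_gt_pi. Qed.

Let n2 : R := x1 ^+ 2 + w1 ^+ 2.
Let n2_gt0 : 0 < n2.
Proof. by rewrite /n2 ltr_pwDl ?sqr_ge0// exprn_even_gt0. Qed.

Let v1_neq0 : v1 != 0.
Proof. by rewrite eq_complex /= negb_and x1_neq0. Qed.

Let ReG : cRe G = X.
Proof. by rewrite /G ReM /= mul0r subr0 divfK. Qed.

Let G_neq0 : G != 0.
Proof. by apply: contraTneq X_gt0 => G0; rewrite -ReG G0 /= ltxx. Qed.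

Let ReG_gt0 : 0 < cRe G. Proof. by rewrite ReG. Qed.

Let v1V : v1^-1 = ((x1 / n2) +i* (- (w1 / n2)))%C.
Proof. by []. Qed.

Let delE : del = - 2 * 'i%C * G / v1.
Proof.
rewrite /G mulrA mulfK//.
apply: complex_ext; rewrite ?(ReM, ImM) /=; field; exact: x1_neq0.
Qed.

Let kapE : kap = al + (X / x1)%:C%C / v1.
Proof.
rewrite /kap; congr (_ + _); rewrite delE !expr2.
have i2 : 'i%C * 'i%C = -1 :> R[i] by rewrite -expr2 sqr_i.
rewrite (_ : - 2 * 'i%C * G / v1 * (- 2 * 'i%C * G / v1) =
  4 * ('i%C * 'i%C) * G * G / v1 / v1); last by ring.
rewrite i2.
have -> : (X / x1)%:C%C / v1 = G / v1 / v1 by rewrite /G mulfK.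
field; exact/andP.
Qed.

Let Re_al : cRe al = - (pi * S / D%:R) / n2.
Proof.
rewrite /al v1V !(ReM, ImM) /= /S; move: (pi : R) => P; field.
by rewrite !gt_eqF.
Qed.

Let Re_al_lt0 : cRe al < 0.
Proof.
rewrite Re_al mulNr oppr_lt0 divr_gt0// divr_gt0// mulr_gt0 ?pi_gt0//.
exact: lt_trans DS.
Qed.

(** The correction has real part [X / n2], so [X < pi S / D] is exactly what makes the coefficients
    of the window decay. *)
Let Re_kap_lt0 : cRe kap < 0.
Proof.
rewrite kapE ReD Re_al v1V ReM /= mul0r subr0 mulrA divfK//.
rewrite mulNr addrC subr_lt0 ltr_pM2r ?invr_gt0//.
Qed.

(** The residue modulo [D], which selects the free parameter; it lies below [D], so the default of
    [inord] never occurs. *)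
Let idx (n : int) : 'I_D := inord `|(n %% D%:Z)%Z|%N.

Let idx_per n m : idx (n + m * D%:Z) = idx n.
Proof. by rewrite /idx addrC modzMDl. Qed.

Let idx_ord (r : 'I_D) : idx (Posz r) = r.
Proof. by rewrite /idx modz_nat absz_nat modn_small// inord_val. Qed.

Let coef (p : 'rV[R[i]]_D) (n : int) : R[i] := p 0 (idx n) * cexp (kap * n%:IC ^+ 2).

Definition theta_window (p : 'rV[R[i]]_D) N (t : R) : R[i] :=
  cexp (- ((G - pi%:C%C) * t%:C%C ^+ 2)) *
  wsum N (fun n => coef p n * cexp (del * n%:IC * t%:C%C)).

(* Its pairing extracts the [r]-th Fourier coefficient, over one period, of the
   trigonometric factor of the window. *)
Definition theta_dual (r : 'I_D) (t : R) : R[i] :=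
  (pi * `|x1| / X)^-1%:C%C * (cexp (kap * (Posz r)%:IC ^+ 2))^-1 *
  cexp ((G - pi%:C%C) * t%:C%C ^+ 2) *
  wave (pi * `|x1| / X) ((2 * X / x1) * (Posz r)%:~R) t.

Let del_imag n t : del * n%:IC * t%:C%C = (0 +i* (- (2 * X / x1) * n%:~R * t))%C.
Proof. by apply: complex_ext; rewrite !(ReM, ImM) /=; ring. Qed.

Let measurable_chirp (c : R[i]) : cmeasurableR (fun t => cexp (c * t%:C%C ^+ 2)).
Proof.
apply: cmeasurable_cexp; apply: cmeasurableM (cmeasurable_cst _ _) _.
under [X in cmeasurable X]eq_fun do rewrite expr2.
exact: cmeasurableM (cmeasurable_real _) (cmeasurable_real _).
Qed.

(** As [del] is imaginary, the exponentials in [t] are unimodular and the trigonometric factor is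
    bounded by the sum of its coefficients. [W] precedes [p] and [N] because [p] will be chosen in
    terms of [N]. *)
Lemma theta_window_dom : exists2 W : R, 0 <= W & forall (p : 'rV[R[i]]_D) N,
  (forall s, cnorm (p 0 s) <= 1) -> gauss_dom W (X - pi) (theta_window p N).
Proof.
have [K K0 HK] := cexp_quad_decay 0 Re_kap_lt0.
have [W W0 HW] := @edecay_wsum R.
exists (K * W) => [|p N p1]; first exact: mulr_ge0.
split=> [|t].
  apply: cmeasurableM.
    have := measurable_chirp (- (G - pi%:C%C)).
    by under [X in cmeasurable X]eq_fun do rewrite mulNr.
  apply: cmeasurable_wsum => n; apply: cmeasurableM (cmeasurable_cst _ _) _.
  apply: cmeasurable_cexp; apply: cmeasurableM (cmeasurable_cst _ _) _.
  exact: cmeasurable_real.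
rewrite /theta_window cnormM mulrC ler_pM ?cnorm_ge0//.
  apply: le_trans (cnorm_wsum _ _) _.
  apply: le_trans (_ : _ <= wsum N (fun n => K * edecay n)) _.
    apply: ler_wsum => n; rewrite cnormM del_imag cexp_imag cnorm_expi mulr1.
    rewrite /coef cnormM.
    rewrite (le_trans _ (HK n))// mul0r addr0 ler_piMl ?cnorm_ge0//.
  rewrite (_ : wsum _ _ = K * wsum N edecay) ?ler_wpM2l//.
  by rewrite /wsum mulr_sumr; apply: eq_bigr => i _; rewrite mulrDr.
rewrite cnorm_cexp ler_expR ReN.
rewrite (_ : cRe _ = (X - pi) * t ^+ 2)//.
by rewrite expr2 !(ReM, ImM) ReD ReN ReG /= expr2; ring.
Qed.

(** A period of the trigonometric factor, whose frequencies are multiples of [2 X / x1]. *)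
Let T : R := pi * `|x1| / X.
Let T_gt0 : 0 < T.
Proof. by rewrite divr_gt0// mulr_gt0 ?pi_gt0// normr_gt0. Qed.

(** The factor [exp((X - pi) t^2)] grows, but only on the bounded support [[0, T]]; the constant
    [exp(2 (X - pi) T^2)] turns this into decay at the rate of the window. *)
Lemma theta_dual_dom r : exists2 W : R, 0 <= W &
  gauss_dom W (X - pi) (theta_dual r).
Proof.
pose c0 : R[i] := T^-1%:C%C * (cexp (kap * (Posz r)%:IC ^+ 2))^-1.
have Xpi : 0 <= X - pi by rewrite subr_ge0 ltW.
exists (cnorm c0 * expR (2 * (X - pi) * T ^+ 2)) => [|].
  by rewrite mulr_ge0 ?cnorm_ge0 ?expR_ge0.
split=> [|t].
  apply: cmeasurableM; last exact: cmeasurable_wave.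
  exact: cmeasurableM (cmeasurable_cst _ _) (measurable_chirp _).
rewrite /theta_dual -/T -/c0 cnormM [cnorm (c0 * _)]cnormM -!mulrA.
rewrite ler_wpM2l ?cnorm_ge0// /wave cnormM cnorm_expi mulr1 cnorm_real indicE.
have [t0T|_] := boolP (_ \in _); last by rewrite normr0 mulr0 mulr_ge0 ?expR_ge0.
have /andP[t0 tT] : (0 <= t) && (t <= T) by move: t0T; rewrite inE /= in_itv.
rewrite normr1 mulr1 cnorm_cexp -expRD ler_expR.
rewrite (_ : cRe _ = (X - pi) * t ^+ 2).
  have : t ^+ 2 <= T ^+ 2 by rewrite ler_sqr ?nnegrE// ltW.
  move: (t ^+ 2) (T ^+ 2) (X - pi) Xpi => a b c c0' ab; nra.
by rewrite expr2 !(ReM, ImM) ReD ReN ReG /= expr2; ring.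
Qed.

Let wave_period (j : int) : expi (2 * X / x1 * j%:~R * T) = 1.
Proof.
have [x10|x10] := ltP 0 x1.
  rewrite (_ : _ * T = 2 * pi * j%:~R) ?expi_int//.
  rewrite /T gtr0_norm//; move: (pi : R) => P; field.
  by rewrite x1_neq0 gt_eqF.
rewrite (_ : _ * T = 2 * pi * (- j)%:~R) ?expi_int//.
rewrite /T ler0_norm// mulrNz; move: (pi : R) => P; field.
by rewrite x1_neq0 gt_eqF.
Qed.

(** The quadratic exponentials cancel, and orthogonality over the period leaves the single term
    [n = r]. The condition [D <= N] puts that index inside the window. *)
Lemma theta_dual_pairing (p : 'rV[R[i]]_D) (r : 'I_D) N : p 0 r = 1 -> (D <= N)%N ->
  cint mu (fun t => theta_window p N t * theta_dual r t) = 1.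
Proof.
move=> pr DN; pose kr := cexp (kap * (Posz r)%:IC ^+ 2).
pose th (n : int) : R := 2 * X / x1 * (Posz r - n)%:~R.
rewrite (@eq_cint _ _ _ mu _ (fun t => T^-1%:C%C * kr^-1 *
  wsum N (fun n => coef p n * wave T (th n) t))); last first.
  move=> t; rewrite /theta_window /theta_dual -/T -/kr.
  set w := wave _ _ _; set c := cexp _; set c' := cexp (_ * t%:C%C ^+ 2).
  have cc : c * c' = 1 by rewrite /c /c' -cexpD addNr cexp0.
  rewrite (_ : c * _ * _ = (c * c') * (T^-1%:C%C * kr^-1) *
    (w * wsum N (fun n => coef p n * cexp (del * n%:IC * t%:C%C)))); last by ring.
  rewrite cc mul1r; congr (_ * _); rewrite -wsumZ; apply: eq_wsum => n.
  rewrite mulrCA; congr (_ * _); rewrite del_imag cexp_imag /w /wave.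
  rewrite -[LHS]mulrA; congr (_ * _); rewrite -expiD; congr expi.
  by rewrite /th intrB; ring.
have iw n : cintegrable mu (fun t => coef p n * wave T (th n) t).
  exact/cintegrableZ/cintegrable_wave.
rewrite cintZ; last first.
  by apply: cintegrable_sum => i; apply: cintegrableD.
rewrite (cint_wsum _ iw).
rewrite (@eq_wsum _ _ _ (fun n => if n == Posz r then kr * T%:C%C else 0)); last first.
  move=> n; rewrite cintZ; last exact: cintegrable_wave.
  have [->|nr] := eqVneq n (Posz r).
    by rewrite /th subrr mulr0 (cint_wave0 (ltW T_gt0)) /coef idx_ord pr mul1r.
  rewrite (cint_wave T_gt0) ?mulr0//; last exact: wave_period.
  apply: mulf_neq0; last by rewrite intr_eq0 subr_eq0 eq_sym.
  by apply: mulf_neq0; rewrite ?invr_neq0// mulf_neq0// gt_eqF.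
rewrite wsum_delta; last exact: leq_trans (ltn_ord r) DN.
have kr0 : kr != 0 by exact: cexp_neq0.
have T0 : T%:C%C != 0 :> R[i].
  by apply/eqP => /(congr1 (@complex.Re R)) /= /eqP; rewrite gt_eqF.
have -> : T^-1%:C%C = T%:C%C^-1 :> R[i] by exact: fmorphV.
move: (kr) (T%:C%C) kr0 T0 => k q k0 q0.
by field; exact/andP.
Qed.

(** Each term is a Gaussian integral with linear coefficient [b n]. In [(b n)^2 / (4 G)] the [n^2]
    part restores [al], the cross term gives the theta exponential, and the rest is the
    prefactor. *)
Lemma theta_window_pairing (p : 'rV[R[i]]_D) N z :
  cint mu (fun t => theta_window p N t *
    cexp (- (pi%:C%C * t%:C%C ^+ 2) + 2 * pi%:C%C * z * t%:C%C)) =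
  cint mu (fun t => cexp (- (G * t%:C%C ^+ 2))) *
  cexp (pi%:C%C ^+ 2 * z ^+ 2 / G) *
  wsum N (fun n => p 0 (idx n) *
    cexp (al * n%:IC ^+ 2 + - 2 * pi%:C%C * 'i%C * z / v1 * n%:IC)).
Proof.
pose b n := del * n%:IC + 2 * pi%:C%C * z.
rewrite (@eq_cint _ _ _ mu _ (fun t => wsum N (fun n => coef p n *
   cexp (- (G * t%:C%C ^+ 2) + b n * t%:C%C)))); last first.
  move=> t; rewrite /theta_window mulrAC -cexpD -wsumZ.
  apply: eq_wsum => n; rewrite mulrCA -cexpD; congr (_ * cexp _).
  by rewrite /b; ring.
rewrite cint_wsum => [|n]; last first.
  apply: cintegrableZ; exact: cintegrable_gaussian_exp.
rewrite -wsumZ; apply: eq_wsum => n.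
rewrite cintZ; last exact: cintegrable_gaussian_exp.
rewrite gaussian_cint// /coef; set J := cint _ _.
transitivity (J * p 0 (idx n) *
    cexp (kap * n%:IC ^+ 2 + b n ^+ 2 / (4 * G))).
  by rewrite cexpD; ring.
transitivity (J * p 0 (idx n) * cexp (pi%:C%C ^+ 2 * z ^+ 2 / G +
    (al * n%:IC ^+ 2 + - 2 * pi%:C%C * 'i%C * z / v1 * n%:IC))); last first.
  by rewrite cexpD; ring.
congr (_ * cexp _).
rewrite /kap /b (_ : - 2 * _ * _ * z / v1 = pi%:C%C * del * z / G).
  by field; exact: G_neq0.
rewrite delE; field; exact/andP.
Qed.

(** Grouping the window by residues makes each prescribed zero one linear equation in the entries of
    [p]. *)
Lemma theta_window_zeros (K : nat) (z : 'I_K -> R[i]) N : (K < D)%N ->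
  exists p : 'rV[R[i]]_D, exists r : 'I_D,
  [/\ p 0 r = 1, forall s, cnorm (p 0 s) <= 1 &
   forall j, wsum N (fun n => p 0 (idx n) *
    cexp (al * n%:IC ^+ 2 + - 2 * pi%:C%C * 'i%C * z j / v1 * n%:IC)) = 0].
Proof.
move=> KD.
pose c j n := cexp (al * n%:IC ^+ 2 + - 2 * pi%:C%C * 'i%C * z j / v1 * n%:IC).
pose M : 'M[R[i]]_(D, K) :=
  \matrix_(r, j) wsum N (fun n => if idx n == r then c j n else 0).
have [p [r [pM pr p1]]] := small_kernel M KD.
exists p, r; split => // j.
have := congr1 (fun A : 'rV_K => A 0 j) pM; rewrite !mxE => <-.
under eq_bigr do rewrite mxE -wsumZ.
rewrite -wsum_sum; apply: eq_wsum => n.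
rewrite (bigD1 (idx n))//= eqxx big1 ?addr0// => i /negbTE ni.
by rewrite eq_sym ni mulr0.
Qed.

(** Quasi-periodicity: translation by [k v1] multiplies the terms by [exp(-2 i pi k n) = 1], while
    translation by [m v2] shifts the index by [- m D] up to a factor, as [p] is read modulo [D]. The
    exact zero at [z] then leaves only the boundary terms of the shift. *)
Lemma theta_window_vanish (z : R[i]) (k m : int) : exists M : R,
  forall (p : 'rV[R[i]]_D) N, (forall s, cnorm (p 0 s) <= 1) ->
  wsum N (fun n => p 0 (idx n) *
    cexp (al * n%:IC ^+ 2 + - 2 * pi%:C%C * 'i%C * z / v1 * n%:IC)) = 0 ->
  cnorm (cint mu (fun t => theta_window p N t *
    cexp (- (pi%:C%C * t%:C%C ^+ 2) +
          2 * pi%:C%C * (z + k%:IC * v1 + m%:IC * v2) * t%:C%C)))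
  <= M * expR (- N%:R).
Proof.
pose be (y : R[i]) := - 2 * pi%:C%C * 'i%C * y / v1.
have [K K0 HK] := cexp_quad_decay (be z) Re_al_lt0.
have [M HM] := wsum_shift_small K (- (m * D%:Z)).
pose z' := z + k%:IC * v1 + m%:IC * v2.
pose C1 := cint mu (fun t => cexp (- (G * t%:C%C ^+ 2))) *
  cexp (pi%:C%C ^+ 2 * z' ^+ 2 / G).
pose mD : R[i] := m%:IC * D%:R.
(* What remains after completing the square to [al (n - m D)^2]. *)
pose C2 := cexp (- al * mD ^+ 2 + be z * mD).
exists (cnorm (C1 * C2) * M) => p N p1 h0.
rewrite theta_window_pairing -/z' -/C1.
pose a n := p 0 (idx n) * cexp (al * n%:IC ^+ 2 + be z * n%:IC).
rewrite (_ : wsum N _ = C2 * wsum N (fun n => a (n + (- (m * D%:Z))))); last first.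
  rewrite -wsumZ; apply: eq_wsum => n.
  rewrite /a -mulNr idx_per.
  suff -> : cexp (al * n%:IC ^+ 2 + be z' * n%:IC) = C2 *
      cexp (al * (n + - m * D%:Z)%:IC ^+ 2 + be z * (n + - m * D%:Z)%:IC) by ring.
  have e1 : cexp (- (2 * pi%:C%C * 'i%C * k%:IC * n%:IC)) = 1.
    rewrite (_ : - _ = (0 +i* (2 * pi * (- (k * n))%:~R))%C).
      by rewrite cexp_imag expi_int.
    rewrite mulrNz intrM; move: (pi : R) => P.
    by apply: complex_ext; rewrite ?ReN ?ImN !(ReM, ImM) /=; ring.
  have alD : al * D%:R = pi%:C%C * 'i%C * v2 / v1.
    rewrite /al rmorphM fmorphV rmorph_nat; field.
    by rewrite v1_neq0 pnatr_eq0.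
  have bz : be z' = be z - 2 * pi%:C%C * 'i%C * k%:IC - 2 * (al * D%:R) * m%:IC.
    by rewrite alD /be /z'; field.
  transitivity (cexp ((- al * mD ^+ 2 + be z * mD) +
    (al * (n%:IC - mD) ^+ 2 + be z * (n%:IC - mD)) +
     - (2 * pi%:C%C * 'i%C * k%:IC * n%:IC))).
    by congr cexp; rewrite bz /mD; ring.
  rewrite cexpD e1 mulr1 cexpD; congr (_ * cexp _).
  have -> // : (n + - m * D%:Z)%:IC = n%:IC - mD.
  by rewrite /mD mulNr intrB intrM rmorphB rmorphM rmorph_nat.
rewrite mulrA cnormM -[leRHS]mulrA ler_wpM2l ?cnorm_ge0//.
apply: HM => // n.
by rewrite /a cnormM (le_trans _ (HK n))// ler_piMl ?cnorm_ge0.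
Qed.

Lemma theta_lattice (K : nat) (z : 'I_K -> R[i]) : (K < D)%N ->
  exists (f : nat -> R -> R[i]) (F : R -> R[i]) (W c : R),
  [/\ 0 < c, forall N, gauss_dom W c (f N), gauss_dom W c F,
      forall N, cint mu (fun t => f N t * F t) = 1 &
      forall j (k m : int) (e : R), 0 < e -> exists N0, forall N, (N0 <= N)%N ->
        cnorm (cint mu (fun t => f N t *
          cexp (- (pi%:C%C * t%:C%C ^+ 2) +
          2 * pi%:C%C * (z j + k%:IC * (x1 +i* w1)%C + m%:IC * v2) * t%:C%C)))
        <= e].
Proof.
move=> KD.
have /choice[pr Hpr] N : exists pr : 'rV[R[i]]_D * 'I_D,
  [/\ pr.1 0 pr.2 = 1, forall s, cnorm (pr.1 0 s) <= 1 &
   forall j, wsum N (fun n => pr.1 0 (idx n) *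
    cexp (al * n%:IC ^+ 2 + - 2 * pi%:C%C * 'i%C * z j / v1 * n%:IC)) = 0].
  by have [p [r H]] := theta_window_zeros z N KD; exists (p, r).
(* The normalised entry of [p] depends on [N]: pass to a subsequence along which
   it does not, so that a single dual function serves. *)
have [r Hr] : exists r, forall N, exists N', (N <= N')%N /\ (pr N').2 = r.
  apply: contrapT => /forallNP H.
  have /choice[B HB] (r : 'I_D) : exists N, forall N', (N <= N')%N -> (pr N').2 <> r.
    have /existsNP[N HN] := H r; exists N => N' NN' E.
    by apply: HN; exists N'.
  pose M := \max_r B r.
  by apply: (HB (pr M).2 M) => //; exact: leq_bigmax.
(* The summand [D] brings the index [r] into the window; the summand [N] makes [phi] tend to
   infinity. *)
have /choice[phi Hphi] N : exists N', (N + D <= N')%N /\ (pr N').2 = r.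
  exact: Hr.
have [W1 W10 HW1] := theta_window_dom.
have [W2 W20 HW2] := theta_dual_dom r.
have mono W W' f : W <= W' -> gauss_dom W (X - pi) f -> gauss_dom W' (X - pi) f.
  move=> WW' [mf fW]; split => // t.
  by rewrite (le_trans (fW t))// ler_wpM2r ?expR_ge0.
pose fN N := theta_window (pr (phi N)).1 (phi N).
exists fN, (theta_dual r), (Num.max W1 W2), (X - pi); split.
- by rewrite subr_gt0.
- move=> N; apply: (mono W1); first by rewrite le_max lexx.
  by apply: HW1; have [] := Hpr (phi N).
- by apply: (mono W2) HW2; rewrite le_max lexx orbT.
- move=> N; have [h1 h2] := Hphi N; apply: theta_dual_pairing.
    by rewrite -h2; have [] := Hpr (phi N).
  exact: leq_trans (leq_addl _ _) h1.
- move=> j k m e e0.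
  have [M HM] := theta_window_vanish (z j) k m.
  have [N0 HN0] := expR_natN_small M e0.
  exists N0 => N NN0; have [h1 _] := Hphi N.
  have [_ p1 p0] := Hpr (phi N).
  apply: le_trans (HM _ _ p1 (p0 j)) _; apply: HN0.
  by rewrite (leq_trans NN0)// (leq_trans _ h1)// leq_addr.
Qed.

End theta_windows.

(** * Finitely many translates of a planar lattice *)

Section planar_lattice.
Context {R : realType}.
Local Notation mu := (@lebesgue_measure R).

Definition gabor_atom (x w t : R) : R[i] :=
  expi (2 * pi * (w * t)) * (2 `^ (1 / 4) * expR (- (pi * (t - x) ^+ 2)))%:C%C.

(** Expanding [(t - x)^2] merges time and frequency into the complex parameter [x + i w] of the
    theta windows, up to a positive constant. *)
Lemma gabor_atomE (x w t : R) : gabor_atom x w t =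
  (2 `^ (1 / 4) * expR (- (pi * x ^+ 2)))%:C%C *
  cexp (- (pi%:C%C * t%:C%C ^+ 2) + 2 * pi%:C%C * (x +i* w)%C * t%:C%C).
Proof.
rewrite /gabor_atom /cexp.
have -> : cIm (- (pi%:C%C * t%:C%C ^+ 2) + 2 * pi%:C%C * (x +i* w)%C * t%:C%C)
    = 2 * pi * (w * t).
  move: (pi : R) => P.
  by rewrite expr2 ImD ImN !(ReM, ImM) /=; ring.
rewrite [RHS]mulrA [LHS]mulrC; congr (_ * _).
apply: complex_ext; last by rewrite ImM /= !(mul0r, mulr0, addr0).
rewrite ReM [cRe _%:C%C]/= [cRe _%:C%C]/= [cIm _%:C%C]/= mul0r subr0.
rewrite -mulrA -expRD; congr (_ * expR _).
move: (pi : R) => P.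
by rewrite expr2 ReD ReN !(ReM, ImM) /=; ring.
Qed.

Let pi_Re_gt0 : 0 < cRe (pi%:C%C : R[i]). Proof. exact: pi_gt0. Qed.

Lemma gauss_dom_atom x w : exists W c : R,
  0 < c /\ gauss_dom W c (gabor_atom x w).
Proof.
have c0 : 0 < cRe (pi%:C%C : R[i]) / 2 by rewrite divr_gt0.
rewrite (funext (gabor_atomE x w)); do 2!eexists; split; first exact: c0.
exact: gauss_domZ (gauss_dom_gaussian_exp _ pi_Re_gt0).
Qed.

Definition annihilates (f : nat -> R -> R[i]) (x w : R) :=
  forall e : R, 0 < e -> exists N0, forall N, (N0 <= N)%N ->
    cnorm (cint mu (fun t => f N t * gabor_atom x w t)) <= e.

(** The obstruction to completeness: one Gaussian dominates every [f N], yet the pairing with [F]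
    does not shrink. The pairing is bilinear, without conjugation. *)
Definition separating (f : nat -> R -> R[i]) (F : R -> R[i]) :=
  exists W c : R,
  [/\ 0 < c, forall N, gauss_dom W c (f N), gauss_dom W c F &
      forall N, cint mu (fun t => f N t * F t) = 1].

(** Each translate splits into [M] translates of the sublattice spanned by [(x1, w1)] and
    [M (x2, w2)], which has area [M s]; the number of parameters is [D = l M + 1]. *)
Lemma lattice_windows_basis (l : nat) (nx nw : 'I_l -> R) (x1 w1 x2 w2 : R) :
  x1 != 0 -> l%:R < x1 * w2 - x2 * w1 ->
  exists f F, separating f F /\ forall j (k m : int),
    annihilates f (nx j + k%:~R * x1 + m%:~R * x2)
                  (nw j + k%:~R * w1 + m%:~R * w2).
Proof.
set s := x1 * w2 - x2 * w1 => x10 ls.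
have sl : 0 < s - l%:R by rewrite subr_gt0.
(* Larger than [1 / (s - l)], so that [l M + 1 < M s]. *)
pose M := (Num.truncn (s - l%:R)^-1).+1.
have M1 : 1 < M%:R * (s - l%:R).
  by rewrite -ltr_pdivrMr// div1r; exact: truncnS_gt.
pose K := #|{: 'I_l * 'I_M}|.
have KE : K = (l * M)%N by rewrite /K card_prod !card_ord.
pose z (i : 'I_K) : R[i] :=
  ((nx (enum_val i).1 +i* nw (enum_val i).1)%C +
    ((enum_val i).2%:R : R)%:C%C * (x2 +i* w2)%C).
pose v2 : R[i] := (M%:R * x2 +i* (M%:R * w2))%C.
have DS : ((l * M).+1)%:R < x1 * cIm v2 - cRe v2 * w1.
  rewrite /= -natr1 natrM.
  rewrite (_ : _ - _ = M%:R * s); last by rewrite /s; ring.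
  by move: M1; rewrite mulrBr; lra.
have KD : (K < (l * M).+1)%N by rewrite KE.
have [f [F [W [c [c0 fW FW fF van]]]]] := theta_lattice x10 DS z KD.
exists f, F; split; first by exists W, c.
move=> j k m e e0.
(* Division of [m] by [M]: the remainder picks the translate of the sublattice, the quotient the
   position in it. *)
pose i : 'I_M := inord `|(m %% M%:Z)%Z|%N.
pose q := (m %/ M%:Z)%Z.
have mE : m = q * M%:Z + i%:Z.
  rewrite {1}(divz_eq m M%:Z) -/q; congr (_ + _).
  rewrite /i inordK; last first.
    by have := ltz_mod m (isT : M%:Z != 0); have := modz_ge0 m (isT : M%:Z != 0); lia.
  by rewrite gez0_abs// modz_ge0.
set x := nx j + _ + _; set w := nw j + _ + _.
pose a := 2 `^ (1 / 4) * expR (- (pi * x ^+ 2)).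
have a0 : 0 < a by rewrite mulr_gt0 ?powR_gt0 ?expR_gt0.
have [N0 HN0] := van (enum_rank (j, i)) k q (e / a) (divr_gt0 e0 a0).
exists N0 => N NN0.
have := HN0 N NN0.
rewrite (_ : z _ + _ + _ = (x +i* w)%C); last first.
  rewrite /z enum_rankK /= /x /w mE /v2 !intrD !intrM.
  by apply: complex_ext; rewrite ?ReD ?ImD !(ReM, ImM) /=; ring.
set g := (fun t => _) => hg.
rewrite (_ : (fun t => f N t * gabor_atom x w t) = fun t => a%:C%C * g t); last first.
  by apply/funext => t; rewrite gabor_atomE /g -/a; ring.
rewrite cintZ; last first.
  apply: gauss_dom_int (gauss_domM (fW N) (gauss_dom_gaussian_exp _ pi_Re_gt0)).
  by rewrite addr_gt0// divr_gt0.
by rewrite cnormM cnorm_real gtr0_norm// mulrC -ler_pdivlMr.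
Qed.

(** The first basis vector needs a nonzero time coordinate. If the first column of [A] fails, the
    second column followed by minus the first spans the same lattice with the same determinant. *)
Lemma lattice_windows (l : nat) (nu : 'I_l -> 'cV[R]_2) (A : 'M[R]_2) :
  l%:R < \det A ->
  exists f F, separating f F /\ forall j v, int_image A v ->
    annihilates f (nu j 0 0 + v 0 0) (nu j 1 0 + v 1 0).
Proof.
move=> ldet.
have o1 (i : 'I_1) : lift (0 : 'I_2) i = 1 by apply: val_inj; rewrite ord1.
have detE : \det A = A 0 0 * A 1 1 - A 0 1 * A 1 0.
  rewrite (expand_det_row _ 0) big_ord_recl big_ord1 /cofactor !det_mx11 !mxE.
  rewrite !o1 (_ : lift 1 0 = 0); last exact: val_inj.
  by rewrite /= expr0 expr1; ring.
have vE (k : 'cV[int]_2) (i : 'I_2) : (A *m map_mx intr k) i 0 =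
    (k 0 0)%:~R * A i 0 + (k 1 0)%:~R * A i 1.
  by rewrite mxE big_ord_recl big_ord1 !mxE o1 ![_ * _%:~R]mulrC.
have [A0|A0] := eqVneq (A 0 0) 0; last first.
  rewrite detE in ldet.
  have [f [F [sf H]]] :=
    lattice_windows_basis (fun j => nu j 0 0) (fun j => nu j 1 0) A0 ldet.
  exists f, F; split => // j _ [k _ <-].
  by rewrite !vE !addrA; exact: H.
have A1 : A 0 1 != 0.
  apply/eqP => A1; move: ldet; rewrite detE A0 A1 !mul0r subr0.
  by rewrite ltNge ler0n.
have ldet' : l%:R < A 0 1 * - A 1 0 - - A 0 0 * A 1 1.
  by apply: (lt_le_trans ldet); rewrite detE A0 !(mul0r, oppr0, subr0, sub0r, mulrN).
have [f [F [sf H]]] :=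
  lattice_windows_basis (fun j => nu j 0 0) (fun j => nu j 1 0) A1 ldet'.
exists f, F; split => // j _ [k _ <-].
have := H j (k 1 0) (- k 0 0).
by rewrite !vE !mulrNz !mulrNN -!addrA ![_%:~R * A _ 0 + _]addrC.
Qed.

End planar_lattice.

(** * Tensors *)

Section tensor_bounds.
Context {R : realType}.
Local Notation mu := (@lebesgue_measure R).

Lemma gauss_dom_ge0 (W c : R) (f : R -> R[i]) : gauss_dom W c f -> 0 <= W.
Proof.
move=> [_ /(_ 0)]; rewrite expr0n mulr0 oppr0 expR0 mulr1.
exact: le_trans (cnorm_ge0 _).
Qed.

Definition gauss_hull (W c t : R) : R[i] := (W * expR (- (c * t ^+ 2)))%:C%C.

Lemma gauss_dom_hull (W c : R) : 0 <= W -> gauss_dom W c (gauss_hull W c).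
Proof.
move=> W0; split=> [|t]; last first.
  by rewrite cnorm_real ger0_norm// mulr_ge0 ?expR_ge0.
apply: cmeasurable_real; apply: measurable_funM => //.
apply: measurableT_comp => //; apply: measurableT_comp => //.
by apply: measurable_funM => //; exact: measurable_funX.
Qed.

Lemma cnorm_tensor_hull d (W c : 'I_d -> R) (f : 'I_d -> R -> R[i]) t :
  (forall i, gauss_dom (W i) (c i) (f i)) ->
  cnorm (tensor f t) <= cnorm (tensor (fun i => gauss_hull (W i) (c i)) t).
Proof.
move=> fW; rewrite /tensor !cnorm_prod; apply: ler_prod => i _.
rewrite cnorm_ge0 /gauss_hull cnorm_real (le_trans _ (ler_norm _))//.
by have [_ ->] := fW i.
Qed.

Lemma cintegrable_tensor d (W c : 'I_d -> R) (f : 'I_d -> R -> R[i]) :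
  (forall i, 0 < c i) -> (forall i, gauss_dom (W i) (c i) (f i)) ->
  cintegrable (lebesgue_tuple R d) (tensor f).
Proof. by move=> c0 fW; apply: (cint_tensor _).1 => i; exact: gauss_dom_int. Qed.

(** The squared modulus of a tensor is again a tensor, with factors [f i] times their conjugates, so
    its integrability is that of a Gaussian-dominated tensor. *)
Lemma L2norm_tensor d (W c : 'I_d -> R) (f : 'I_d -> R -> R[i]) :
  (forall i, 0 < c i) -> (forall i, gauss_dom (W i) (c i) (f i)) ->
  (L2norm (tensor f) < +oo)%E.
Proof.
move=> c0 fW.
pose f2 i t := f i t * ((cRe (f i t) -i* cIm (f i t))%C).
have f2E t : cRe (tensor f2 t) = cnorm (tensor f t) ^+ 2.
  rewrite /tensor cnorm_prod -prodrXl.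
  rewrite (eq_bigr (fun i => (cnorm (f i (tnth t i)) ^+ 2)%:C%C)); last first.
    move=> i _; apply: complex_ext; rewrite /f2 ?ReM ?ImM cnorm_sqr /=; ring.
  by rewrite -rmorph_prod.
have [if2 _] : cintegrable (lebesgue_tuple R d) (tensor f2).
  apply: (@cintegrable_tensor _ (fun i => W i * W i) (fun i => c i + c i)).
    by move=> i; rewrite addr_gt0.
  move=> i; apply: gauss_domM => //; have [[mr mi] fi] := fW i; split.
    by split => //=; exact: measurable_funN.
  move=> t; apply: le_trans (fi t); rewrite -ler_sqr ?nnegrE ?cnorm_ge0//.
  by rewrite !cnorm_sqr /= sqrrN.
rewrite /L2norm unlock; apply: poweR_lty.
have := integrable_lty measurableT if2.
congr (_ < _)%E; apply: eq_integral => t _ /=.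
rewrite f2E ger0_norm ?cnorm_ge0//.
by rewrite powR_mulrn ?cnorm_ge0.
Qed.

(** Both exponents are 2. The majorant [h] replaces [f] on the right, which makes the bound uniform
    when [f] runs through a dominated sequence. *)
Lemma Re_cint_hoelder d (f g : d.-tuple R -> R[i]) (h : d.-tuple R -> R[i]) :
  cmeasurable f -> cmeasurable g -> cmeasurable h ->
  cintegrable (lebesgue_tuple R d) (fun t => f t * g t) ->
  (forall t, cnorm (f t) <= cnorm (h t)) ->
  ((cRe (cint (lebesgue_tuple R d) (fun t => f t * g t)))%:E <=
   L2norm h * L2norm g)%E.
Proof.
move=> mf mg mh ifg fh.
have := @hoelder _ _ _ (lebesgue_tuple R d) (fun t => cnorm (h t))
  (fun t => cnorm (g t)) 2 2 (cmeasurable_cnorm mh) (cmeasurable_cnorm mg).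
move=> /(_ ltac:(by []) ltac:(by []) ltac:(by rewrite [RHS]splitr !div1r)).
apply: le_trans.
rewrite Lnorm1.
have [ir _] := ifg.
rewrite Re_cint /Rintegral fineK; last exact: integrable_fin_num.
apply: (@le_trans _ _ (\int[lebesgue_tuple R d]_t `|(cRe (f t * g t))%:E|)%E).
  apply: le_trans (le_abse_integral _ _ _) => //; first exact: lee_abs.
  exact: measurable_int ir.
apply: ge0_le_integral => //.
- by apply: measurableT_comp => //; exact: measurable_int ir.
- apply: measurableT_comp => //; apply/measurable_EFinP.
  by apply: measurable_funM; exact: cmeasurable_cnorm.
- move=> t _ /=; rewrite lee_fin (le_trans (cnorm_Re _))// cnormM.
  by rewrite (le_trans _ (ler_norm _))// ler_wpM2r ?cnorm_ge0.
Qed.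

(** Phase and Gaussian turn sums over the coordinates into products, and [2^(d/4)] splits into [d]
    factors [2^(1/4)]. *)
Lemma tfshift_gaussian d (lam : 'cV[R]_(d + d)) :
  tfshift lam (gaussian (d := d)) =
  tensor (fun i => gabor_atom (usubmx lam i 0) (dsubmx lam i 0)).
Proof.
apply/funext => t; rewrite /tfshift /gaussian /tensor /gabor_atom big_split /=.
congr (_ * _).
  rewrite mulr_sumr; elim/big_rec2 : _ => [|i y1 y2 _ IH].
    by rewrite /expi cos0 sin0.
  by rewrite expiD IH.
rewrite -rmorph_prod big_split /= prodr_const card_ord -expR_sum.
apply: (congr1 (fun x : R => x%:C%C)); congr (_ * expR _).
  by rewrite -powR_mulrn ?powR_ge0// -powRrM mulrC mul1r.
rewrite mulr_sumr -sumrN; apply: eq_bigr => i _.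
by rewrite tnth_mktuple.
Qed.

End tensor_bounds.

(** * Coset representatives and incompleteness *)

Lemma index_representatives (V : zmodType) (H L : set V) (n : nat) :
  subgroup_of_index H L n ->
  exists nu : nat -> V, forall v, L v ->
    exists2 k, (k < n)%N & exists2 h, H h & v = nu k + h.
Proof.
move=> [[H0 _] HL /card_set_bijP[g [gfun ginj _]]].
have H0' : H 0 by move: H0; rewrite inE.
pose C v := [set v + h | h in H].
have CL v : L v -> cosets H L (C v) by move=> Lv; exists v.
(* A representative for each coset number, with default 0; injectivity of the numbering [g] will
   identify the coset of [v] with that of its representative. *)
have /choice[nu Hnu] (k : nat) : exists v, forall u, L u -> g (C u) = k ->
    L v /\ g (C v) = k.
  have [[v [Lv gv]]|none] := pselect (exists v, L v /\ g (C v) = k).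
    by exists v.
  by exists 0 => u Lu gu; exfalso; apply: none; exists u.
exists nu => v Lv; exists (g (C v)); first exact: (gfun _ (CL _ Lv)).
have [Lnu gnu] := Hnu _ v Lv erefl.
have E : C (nu (g (C v))) = C v.
  by apply: ginj => //; rewrite inE; exact: CL.
have : C v v by exists 0 => //; rewrite addr0.
by rewrite -[X in X v]E => -[h Hh e]; exists h.
Qed.

Theorem theorem10 (R : realType) (d n : nat) (A : 'I_d -> 'M[R]_2)
    (L : set 'cV[R]_(d + d))
    (d_gt0 : (0 < d)%N)
    (A_unit : forall i : 'I_d, A i \in unitmx)
    (L_lattice : lattice L)
    (L_index : subgroup_of_index (odot (fun i : 'I_d => int_image (A i))) L n)
    (l_exists : exists l : 'I_d -> nat,
      [/\ forall i : 'I_d, (0 < l i)%N,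
          (\sum_(i < d) l i)%N = n &
          forall i : 'I_d, (l i)%:R < \det (A i)]) :
  ~ L2_complete (gabor (gaussian (d := d)) L).
Proof.
have [l [_ ln ldet]] := l_exists.
have [nu nuL] := index_representatives L_index.
(* One pair [(i, j)] per coset: as the [l i] add up to [n], enumerating [I] deals [l i] cosets to
   coordinate [i]. *)
pose I := {i : 'I_d & 'I_(l i)}.
have cardI : #|{: I}| = n.
  rewrite card_tagged -ln sumnE big_map big_enum /=.
  by apply: eq_bigr => i _; rewrite card_ord.
pose proj i (v : 'cV[R]_(d + d)) : 'cV[R]_2 :=
  \col_(k < 2) (if k == 0 then usubmx v i 0 else dsubmx v i 0).
pose pts i (j : 'I_(l i)) : 'cV[R]_2 :=
  proj i (nu (enum_rank (Tagged (fun i => 'I_(l i)) j))).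
have /choice[fF HfF] i : exists fF : (nat -> R -> R[i]) * (R -> R[i]),
  separating fF.1 fF.2 /\ forall j v, int_image (A i) v ->
    annihilates fF.1 (pts i j 0 0 + v 0 0) (pts i j 1 0 + v 1 0).
  have [f [F H]] := lattice_windows (pts i) (ldet i).
  by exists (f, F).
pose f i := (fF i).1; pose F i := (fF i).2.
(* The coset of [lam] was dealt to one coordinate, where [lam] projects into one of the translates
   treated there. *)
have annih lam : L lam -> exists i,
    annihilates (f i) (usubmx lam i 0) (dsubmx lam i 0).
  move=> Llam; have [k kn [h Hh lamE]] := nuL _ Llam.
  pose k' : 'I_#|{: I}| := cast_ord (esym cardI) (Ordinal kn).
  pose a := enum_val k'.
  have [_ /(_ (tagged a) _ (Hh (tag a)))] := HfF (tag a).
  rewrite /pts (_ : nu _ = nu k); last first.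
    by rewrite (_ : Tagged _ _ = a) ?enum_valK//; case: (a).
  by rewrite !mxE /= lamE => an; exists (tag a); move: an; rewrite !mxE.
have /choice[Wc HWc] i : exists Wc : R * R,
  [/\ 0 < Wc.2, forall N, gauss_dom Wc.1 Wc.2 (f i N),
   gauss_dom Wc.1 Wc.2 (F i) & forall N,
     cint (@lebesgue_measure R) (fun t => f i N t * F i t) = 1].
  by have [[W [c H]] _] := HfF i; exists (W, c).
pose W i := (Wc i).1; pose c i := (Wc i).2.
have c0 i : 0 < c i by have [] := HWc i.
have fW i N : gauss_dom (W i) (c i) (f i N) by have [] := HWc i.
have FW i : gauss_dom (W i) (c i) (F i) by have [] := HWc i.
have fF1 i N : cint (@lebesgue_measure R) (fun t => f i N t * F i t) = 1.
  by have [] := HWc i.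
have W0 i : 0 <= W i by exact: gauss_dom_ge0 (FW i).
pose mud := lebesgue_tuple R d.
pose fd N := tensor (fun i => f i N).
pose Fd := tensor F.
pose G := tensor (fun i => gauss_hull (W i) (c i)).
have GW i := gauss_dom_hull (c i) (W0 i).
have Goo : (L2norm G < +oo)%E by exact: L2norm_tensor c0 GW.
have iFd : cintegrable mud Fd by exact: cintegrable_tensor c0 FW.
have L2Fd : L2 Fd.
  have [mr mi] := cintegrable_measurable iFd.
  by split => //; exact: L2norm_tensor c0 FW.
have fdFd1 N : cintegrable mud (fun t => fd N t * Fd t) /\
    cint mud (fun t => fd N t * Fd t) = 1.
  have E : (fun t => fd N t * Fd t) = tensor (fun i t => f i N t * F i t).
    by apply/funext => t; rewrite tensorM.
  have [i1 i2] : cintegrable mud (tensor (fun i t => f i N t * F i t)) /\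
      cint mud (tensor (fun i t => f i N t * F i t)) =
      \prod_i cint (@lebesgue_measure R) (fun t => f i N t * F i t).
    apply: cint_tensor => i.
    apply: gauss_dom_int (gauss_domM (fW i N) (FW i)).
    by rewrite addr_gt0.
  by rewrite E i2; split => //; apply: big1 => i _; exact: fF1.
(* The pairing factors over the coordinates: one factor tends to 0, the others stay below bounds
   [B i] independent of [N]. *)
have atom0 lam : L lam ->
    (forall N, cintegrable mud (fun t => fd N t * tfshift lam (gaussian (d:=d)) t)) /\
    forall e : R, 0 < e -> exists N0, forall N, (N0 <= N)%N ->
      cnorm (cint mud (fun t => fd N t * tfshift lam (gaussian (d := d)) t)) <= e.
  move=> Llam; rewrite tfshift_gaussian.
  set at_ := (fun i => gabor_atom _ _).
  have /choice[Wa HWa] i : exists Wa : R * R,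
      0 < Wa.2 /\ gauss_dom Wa.1 Wa.2 (at_ i).
    have [Wa [ca H]] := gauss_dom_atom (usubmx lam i 0) (dsubmx lam i 0).
    by exists (Wa, ca).
  have dom i N : gauss_dom (W i * (Wa i).1) (c i + (Wa i).2)
      (fun t => f i N t * at_ i t).
    by apply: gauss_domM => //; have [] := HWa i.
  have cc0 i : 0 < c i + (Wa i).2 by have [? _] := HWa i; rewrite addr_gt0.
  have E N : (fun t => fd N t * tensor at_ t) = tensor (fun i t => f i N t * at_ i t).
    by apply/funext => t; rewrite tensorM.
  have H N := cint_tensor (fun i => gauss_dom_int (cc0 i) (dom i N)).
  split=> [N|e e0]; first by rewrite E; have [] := H N.
  pose B i := 2 * \int[@lebesgue_measure R]_t
    (W i * (Wa i).1 * expR (- ((c i + (Wa i).2) * t ^+ 2))).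
  have HB i N : cnorm (cint (@lebesgue_measure R)
      (fun t => f i N t * at_ i t)) <= B i.
    by have [mf fW'] := dom i N; exact: (cnorm_cint mf (integrable_gauss _ (cc0 i)) fW').
  have B0 i : 0 <= B i by exact: le_trans (cnorm_ge0 _) (HB i 0%N).
  have [i0 an] := annih lam Llam.
  pose P := \prod_(i | i != i0) B i.
  have P0 : 0 <= P by exact: prodr_ge0.
  have [N0 HN0] := an (e / (P + 1)) (divr_gt0 e0 (ltr_wpDl P0 ltr01)).
  exists N0 => N NN0; have [_ HN] := H N; rewrite E HN.
  rewrite cnorm_prod (bigD1 i0)//.
  apply: le_trans (_ : e / (P + 1) * P <= e).
    apply: ler_pM.
    - exact: cnorm_ge0.
    - by apply: prodr_ge0 => i _; exact: cnorm_ge0.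
    - exact: HN0.
    - by apply: ler_prod => i _; rewrite cnorm_ge0 HB.
  rewrite mulrAC ler_pdivrMr ?ltr_wpDl// ler_wpM2l ?(ltW e0)//.
  by rewrite lerDl.
move=> /(_ Fd L2Fd) complete.
pose g := fine (L2norm G).
have g0 : 0 <= g by rewrite fine_ge0// Lnorm_ge0.
(* Chosen so that the Hölder bound [g e] is below 1/2. *)
pose e := (2 * (g + 1))^-1.
have e0 : 0 < e by rewrite invr_gt0 mulr_gt0// ltr_wpDl.
have [h [m [a [s [Ss hE]]]] he] := complete e e0.
have /choice[lam Hlam] k : exists lam, L lam /\ tfshift lam (gaussian (d := d)) = s k.
  by have [lam Llam lamE] := Ss k; exists lam.
have atoms k : (forall N, cintegrable mud (fun t => fd N t * s k t)) /\
    forall e : R, 0 < e -> exists N0, forall N, (N0 <= N)%N ->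
      cnorm (cint mud (fun t => fd N t * s k t)) <= e.
  by have [Llam <-] := Hlam k; exact: atom0.
have ms k : cmeasurable (s k).
  have [_ <-] := Hlam k; rewrite tfshift_gaussian; apply: cmeasurable_prod => i.
  apply: (cmeasurable_comp (h := fun t : d.-tuple R => tnth t i)).
    exact: measurable_tnth.
  by have [? [? [_ []]]] := gauss_dom_atom (usubmx (lam k) i 0) (dsubmx (lam k) i 0).
(* The [m] terms together contribute at most 1/2; [m.+1] keeps the threshold positive when
   [m = 0]. *)
have /choice[N0 HN0] k : exists N0, forall N, (N0 <= N)%N ->
    cnorm (a k * cint mud (fun t => fd N t * s k t)) <= (2 * m.+1%:R)^-1.
  have [_ /(_ ((2 * m.+1%:R)^-1 / (cnorm (a k) + 1)))] := atoms k.
  have ak1 : 0 < cnorm (a k) + 1 by rewrite ltr_wpDl ?cnorm_ge0.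
  have mp : 0 < (2 * m.+1%:R)^-1 :> R by rewrite invr_gt0 mulr_gt0.
  move=> /(_ (divr_gt0 mp ak1)) [N0 H]; exists N0 => N NN0.
  rewrite cnormM; apply: le_trans (ler_wpM2l (cnorm_ge0 _) (H N NN0)) _.
  rewrite mulrCA ler_piMr ?(ltW mp)// ler_pdivrMr// mul1r lerDl.
  exact: ler01.
pose N := \max_k N0 k.
have ifh : cintegrable mud (fun t => fd N t * h t) /\
    cint mud (fun t => fd N t * h t) =
    \sum_(k < m) a k * cint mud (fun t => fd N t * s k t).
  have is_ k : cintegrable mud (fun t => a k * (fd N t * s k t)).
    by apply: cintegrableZ; have [] := atoms k.
  have -> : (fun t => fd N t * h t) =
      (fun t => \sum_(k < m) a k * (fd N t * s k t)).
    apply/funext => t; rewrite hE mulr_sumr; apply: eq_bigr => k _.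
    by rewrite mulrCA.
  split; first exact: cintegrable_sum.
  rewrite cint_sum//; apply: eq_bigr => k _; rewrite cintZ//.
  by have [] := atoms k.
have [ih Eh] := ifh.
have small : cnorm (cint mud (fun t => fd N t * h t)) <= 2^-1.
  rewrite Eh (le_trans (cnorm_sum _ _ _))//.
  apply: le_trans (_ : \sum_(k < m) (2 * m.+1%:R)^-1 <= _).
    by apply: ler_sum => k _; apply: HN0; exact: leq_bigmax.
  rewrite sumr_const card_ord -[leLHS]mulr_natr invfM -mulrA ler_piMr//.
  by rewrite mulrC ler_pdivrMr// mul1r ler_nat.
have [iF EF] := fdFd1 N.
have Ediff : (fun t => fd N t * (Fd \- h) t) =
    (fun t => fd N t * Fd t + (-1) * (fd N t * h t)).
  by apply/funext => t /=; rewrite mulrBr mulN1r.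
have idiff : cintegrable mud (fun t => fd N t * (Fd \- h) t).
  by rewrite Ediff; apply: cintegrableD => //; exact: cintegrableZ.
have Ecint : cint mud (fun t => fd N t * (Fd \- h) t) =
    1 - cint mud (fun t => fd N t * h t).
  by rewrite Ediff cintD ?EF ?cintZ ?mulN1r//; exact: cintegrableZ.
have mFd := cintegrable_measurable iFd.
have mh : cmeasurable h.
  rewrite hE; apply: cmeasurable_sum => k.
  exact: cmeasurableM (cmeasurable_cst _ _) (ms k).
have mdiff : cmeasurable (Fd \- h).
  have -> : (Fd \- h) = (fun t => Fd t + (-1) * h t).
    by apply/funext => t /=; rewrite mulN1r.
  by apply: cmeasurableD => //; exact: cmeasurableM (cmeasurable_cst _ _) mh.
have mfd : cmeasurable (fd N).
  by apply: cintegrable_measurable; exact: cintegrable_tensor c0 (fun i => fW i N).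
have mG : cmeasurable G.
  by apply: cintegrable_measurable; exact: cintegrable_tensor c0 GW.
(* The contradiction: the pairing of [fd N] with [Fd - h] has real part at least 1/2, while Hölder
   and [he] bound it by [g e]. *)
have := @Re_cint_hoelder _ _ (fd N) (Fd \- h) G mfd mdiff mG idiff
  (fun t => cnorm_tensor_hull t (fun i => fW i N)).
apply/negP; rewrite -ltNge.
have gE : L2norm G = g%:E by rewrite fineK// ge0_fin_numE// Lnorm_ge0.
apply: (@le_lt_trans _ _ (g%:E * e%:E)%E).
  by rewrite gE lee_wpmul2l ?lee_fin// ltW.
rewrite -EFinM lte_fin Ecint ReD ReN.
apply: (@lt_le_trans _ _ 2^-1).
  rewrite /e invfM mulrCA -ltr_pdivlMl ?invrK ?mulfV// ?mul1r.
  by rewrite ltr_pdivrMr ?ltr_wpDl// mul1r ltrDl.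
rewrite lerBrDr -lerBrDl (le_trans (ler_norm _))//.
rewrite (le_trans (cnorm_Re _))// (le_trans small)//=.
by rewrite [X in X - _](splitr 1) div1r addrK.
Qed.
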